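(* Let $(g,f,\Phi)$ be admissible saddle-point data, fix $(x^*,y^* )\in\Omega$, and let $\{(x_n,y_n)\}$ and the step sizes $\{\tau_n\}$ be generated by the algorithm NPDAL-n. Then there exists a constant $C_1>0$ such that for every $N\ge1$, $$J(\hat x_N,\hat y_N)\le\frac{C_1}{N},\qquad\text{where}\quad \hat x_N=\frac1{s_N}\sum_{n=1}^N\tau_nx_n,\quad \hat y_N=\frac1{s_N}\sum_{n=1}^N\tau_ny_n,\quad s_N=\sum_{n=1}^N\tau_n,$$ and $J(x,y)=\mathcal{L}(x,y^* )-\mathcal{L}(x^*,y)$.
   Context: **Problem.** $g:\mathbb{R}^q\to(-\infty,+\infty]$ and $f:\mathbb{R}^p\to(-\infty,+\infty]$ are proper, closed, convex; $f^*$ is the Legendre–Fenchel conjugate of $f$; $\Phi:\mathrm{dom}(g)\times\mathrm{dom}(f^* )\to\mathbb{R}$. Put $\mathcal{L}(x,y)=g(x)+\Phi(x,y)-f^*(y)$. A saddle point is a pair $(x^*,y^* )\in\mathrm{dom}(g)\times\mathrm{dom}(f^* )$ with $\mathcal{L}(x^*,y)\le\mathcal{L}(x^*,y^* )\le\mathcal{L}(x,y^* )$ for all $(x,y)\in\mathrm{dom}(g)\times\mathrm{dom}(f^* )$; $\Omega$ is the set of saddle points. **Admissible data** means: (1) $\Omega\ne\emptyset$ and $\mathcal{L}(x^*,y^* )$ is finite; (2) $\Phi$ is continuous; for each fixed $y\in\mathrm{dom}(f^* )$ it is convex and differentiable in $x$ over $\mathrm{dom}(g)$, and for each fixed $x\in\mathrm{dom}(g)$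 it is concave and differentiable in $y$ over $\mathrm{dom}(f^* )$; (3) for any bounded $\mathcal{X}\subset\mathbb{R}^q$, $\mathcal{Y}\subset\mathbb{R}^p$ there are $L_{xx}\ge0$, $L_{yy}\ge0$, $L_{xy}>0$ such that for all $x,\tilde x\in\mathcal{X}\cap\mathrm{dom}(g)$, $y,\tilde y\in\mathcal{Y}\cap\mathrm{dom}(f^* )$: $\|\nabla_y\Phi(x,y)-\nabla_y\Phi(x,\tilde y)\|\le L_{yy}\|y-\tilde y\|$ and $\|\nabla_x\Phi(x,y)-\nabla_x\Phi(\tilde x,\tilde y)\|\le L_{xx}\|x-\tilde x\|+L_{xy}\|y-\tilde y\|$. $\mathrm{Prox}_{\lambda\phi}(x)=\operatorname{argmin}_u\{\phi(u)+\frac1{2\lambda}\|u-x\|^2\}$. **Algorithm NPDAL-n.** Parameters: $\psi\in(1,1+\sqrt3)$, $a\in(0,1)$, $b\in[0,1)$, $\xi>0$, $1<\varphi<\psi$, $0<\xi_1<1/\varphi$ such that $\omega_1:=(1-a)\bigl(2\psi-\xi-\frac{\psi^3\varphi}{1+\psi}\bigr)-\frac a{\xi_1}>0$; $\tau_{\max}>0$, $\nu\in(0,1)$, $\mu\in(0,1)$, $\eta\in[0,1)$, integer $M\ge1$, $\beta>0$, $\tau_0\in(0,\tau_{\max}]$, $\delta_0>0$. Start: $x_0\in\mathrm{dom}(g)$, $y_0\in\mathrm{dom}(f^* )$, $z_0=x_0$, $\bar z_0=y_0$. For $n=1,2,\dots$: 1. $z_n=\frac{\psi-1}\psi x_{n-1}+\frac1\psi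 z_{n-1}$, $x_n^{md}=ax_{n-1}+(1-a)z_n$, $x_n=\mathrm{Prox}_{\tau_{n-1}g}(x_n^{md}-\tau_{n-1}\nabla_x\Phi(x_{n-1},y_{n-1}))$. 2. $\bar z_n=(1-b)y_{n-1}+b\bar z_{n-1}$, $y_n^{md}=by_{n-1}+(1-b)\bar z_n$. 3. (Linesearch) With $\tau=\min\{\varphi\tau_{n-1},\tau_{\max}\}$, let $\tau_n=\tau\mu^i$ with $i$ the first of $0,1,2,\dots$ for which, with $y_n=\mathrm{Prox}_{\beta\tau_nf^*}(y_n^{md}+\beta\tau_n\nabla_y\Phi(x_n,y_{n-1}))$, $$\frac{\tau_n\tau_{n-1}}{(1-a)\xi}\|\theta_n\|^2+2\tau_n\Phi_n^y\le\nu r_n+(1-\nu)c_n,$$ where $\theta_n=\nabla_x\Phi(x_n,y_n)-\nabla_x\Phi(x_{n-1},y_{n-1})$, $\Phi_n^y=\Phi(x_n,y_{n-1})+\langle\nabla_y\Phi(x_n,y_{n-1}),y_n-y_{n-1}\rangle-\Phi(x_n,y_n)$, $r_n=\omega_1\delta_{n-1}\|x_n-x_{n-1}\|^2+\frac b\beta\|y_n-y_{n-1}\|^2+\frac1\beta(1-b)(1+b)\|y_n-\bar z_n\|^2$, $c_n=\frac{\eta}{|I_n|}\sum_{i\in I_n}r_i$, $I_n=\{n-1,n-2,\dots,\max\{n-M,1\}\}$ for $n\ge2$, and $c_1=0$. 4. $\delta_n=\tau_n/\tau_{n-1}$. *)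

(* Defs.v *)
From mathcomp Require Import all_boot all_order all_algebra.
From mathcomp Require Import boolp classical_sets functions reals ereal.
From mathcomp Require Import interval_inference topology normedtype convex.

Set Implicit Arguments.
Unset Strict Implicit.
Unset Printing Implicit Defensive.

Import Order.TTheory GRing.Theory Num.Theory.
Import numFieldNormedType.Exports.

Local Open Scope classical_set_scope.
Local Open Scope ring_scope.

Section ConvexAnalysis.
Context {R : realType} {n : nat}.
Implicit Types (u v x y : 'rV[R]_n) (h : 'rV[R]_n -> \bar R).

Definition dotv u v : R := \sum_(i < n) u ord0 i * v ord0 i.

(* The library norm `|u| on matrices is the sup norm; it induces the same
   topology and the same bounded sets as the Euclidean norm. *)
Definition enorm u : R := Num.sqrt (dotv u u).

Definition edom h : set 'rV[R]_n := [set x | (h x < +oo)%E].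

Definition proper h : Prop := (forall x, h x != -oo%E) /\ edom h !=set0.

(* Weights are in the open interval (0, 1), so no product 0 * +oo occurs. *)
Definition econvex h : Prop :=
  forall x y (t : R), 0 < t -> t < 1 ->
    (h (t *: x + (1 - t) *: y)%R <= t%:E * h x + (1 - t)%:E * h y)%E.

Definition proper_closed_convex h : Prop :=
  [/\ proper h, lower_semicontinuous h & econvex h].

Definition fconj h y : \bar R :=
  ereal_sup [set ((dotv x y)%:E - h x)%E | x in [set: 'rV[R]_n]].

Definition argmin h : set 'rV[R]_n := [set u | forall v, (h u <= h v)%E].

(* For lam > 0 and h proper, closed and convex, the set argmin below is a
   singleton; the default value 0 is then irrelevant. *)
Definition prox (lam : R) h x : 'rV[R]_n :=
  xget 0 (argmin (fun u => (h u + ((2 * lam)^-1 * enorm (u - x) ^+ 2)%:E)%E)).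

(* v is a gradient at x of k, a real function that only matters on D.  The
   increments are taken inside D, which need not be open; v is unique if D is
   convex with nonempty interior. *)
Definition is_gradient (D : set 'rV[R]_n) (k : 'rV[R]_n -> R) x v : Prop :=
  (fun u => (k u - k x - dotv v (u - x)) / enorm (u - x)) @ within D x^'
    --> (0 : R).

End ConvexAnalysis.

Section SaddlePoint.
Context {R : realType} {q p : nat}.
Variables (g : 'rV[R]_q -> \bar R) (f : 'rV[R]_p -> \bar R).
(* Only the values of Phi and of its partial gradients on
   edom g `*` edom (fconj f) are constrained and used. *)
Variable Phi : 'rV[R]_q -> 'rV[R]_p -> R.
Variables (gradx : 'rV[R]_q -> 'rV[R]_p -> 'rV[R]_q)
          (grady : 'rV[R]_q -> 'rV[R]_p -> 'rV[R]_p).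

Definition lagr (x : 'rV[R]_q) (y : 'rV[R]_p) : \bar R :=
  (g x + (Phi x y)%:E - fconj f y)%E.

Definition saddle : set ('rV[R]_q * 'rV[R]_p) :=
  [set s | [/\ edom g s.1, edom (fconj f) s.2 &
    forall x y, edom g x -> edom (fconj f) y ->
      (lagr s.1 y <= lagr s.1 s.2)%E /\ (lagr s.1 s.2 <= lagr x s.2)%E]].

Definition gap (xs : 'rV[R]_q) (ys : 'rV[R]_p) x y : \bar R :=
  (lagr x ys - lagr xs y)%E.

Definition smooth_convex_concave : Prop :=
  [/\ {within edom g `*` edom (fconj f), continuous (fun s => Phi s.1 s.2)},
      forall y, edom (fconj f) y ->
        convex_function (edom g) (fun x => Phi x y) /\
        (forall x, edom g x ->
           is_gradient (edom g) (fun u => Phi u y) x (gradx x y)) &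
      forall x, edom g x ->
        convex_function (edom (fconj f)) (fun y => - Phi x y) /\
        (forall y, edom (fconj f) y ->
           is_gradient (edom (fconj f)) (fun v => Phi x v) y (grady x y))].

Definition locally_lipschitz_gradients : Prop :=
  forall (X : set 'rV[R]_q) (Y : set 'rV[R]_p),
    bounded_set X -> bounded_set Y ->
    exists Lxx Lyy Lxy : R, [/\ 0 <= Lxx, 0 <= Lyy, 0 < Lxy &
      forall x x' y y',
        (X `&` edom g) x -> (X `&` edom g) x' ->
        (Y `&` edom (fconj f)) y -> (Y `&` edom (fconj f)) y' ->
        enorm (grady x y - grady x y') <= Lyy * enorm (y - y') /\
        enorm (gradx x y - gradx x' y') <=
          Lxx * enorm (x - x') + Lxy * enorm (y - y')].

Definition admissible : Prop :=
  [/\ saddle !=set0,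
      (forall s, saddle s -> lagr s.1 s.2 \is a fin_num),
      smooth_convex_concave & locally_lipschitz_gradients].

End SaddlePoint.

Record npdal_params (R : realType) := NPDALParams {
  par_psi : R; par_a : R; par_b : R; par_xi : R; par_phi : R; par_xi1 : R;
  par_taumax : R; par_nu : R; par_mu : R; par_eta : R; par_M : nat;
  par_beta : R; par_tau0 : R; par_delta0 : R }.

Definition omega1 (R : realType) (P : npdal_params R) : R :=
  let psi := par_psi P in
  (1 - par_a P) * (2 * psi - par_xi P - psi ^+ 3 * par_phi P / (1 + psi))
  - par_a P / par_xi1 P.

Record valid_params (R : realType) (P : npdal_params R) : Prop := ValidParams {
  vp_psi : 1 < par_psi P < 1 + Num.sqrt 3;
  vp_a : 0 < par_a P < 1;
  vp_b : 0 <= par_b P < 1;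
  vp_xi : 0 < par_xi P;
  vp_phi : 1 < par_phi P < par_psi P;
  vp_xi1 : 0 < par_xi1 P < (par_phi P)^-1;
  vp_omega1 : 0 < omega1 P;
  vp_taumax : 0 < par_taumax P;
  vp_nu : 0 < par_nu P < 1;
  vp_mu : 0 < par_mu P < 1;
  vp_eta : 0 <= par_eta P < 1;
  vp_M : (1 <= par_M P)%N;
  vp_beta : 0 < par_beta P;
  vp_tau0 : 0 < par_tau0 P <= par_taumax P;
  vp_delta0 : 0 < par_delta0 P }.

Record npdal_run (R : realType) (q p : nat) := NPDALRun {
  seq_x : nat -> 'rV[R]_q;
  seq_z : nat -> 'rV[R]_q;
  seq_y : nat -> 'rV[R]_p;
  seq_zb : nat -> 'rV[R]_p;
  seq_tau : nat -> R;
  seq_delta : nat -> R }.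

Section Algorithm.
Context {R : realType} {q p : nat}.
Variables (g : 'rV[R]_q -> \bar R) (f : 'rV[R]_p -> \bar R).
Variable Phi : 'rV[R]_q -> 'rV[R]_p -> R.
Variables (gradx : 'rV[R]_q -> 'rV[R]_p -> 'rV[R]_q)
          (grady : 'rV[R]_q -> 'rV[R]_p -> 'rV[R]_p).
Variables (P : npdal_params R) (S : npdal_run R q p).

Local Notation psi := (par_psi P).
Local Notation a := (par_a P).
Local Notation b := (par_b P).
Local Notation beta := (par_beta P).
Local Notation x := (seq_x S).
Local Notation z := (seq_z S).
Local Notation y := (seq_y S).
Local Notation zb := (seq_zb S).
Local Notation tau := (seq_tau S).
Local Notation delta := (seq_delta S).

Definition xmd (n : nat) : 'rV[R]_q := a *: x n.-1 + (1 - a) *: z n.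

Definition ymd (n : nat) : 'rV[R]_p := b *: y n.-1 + (1 - b) *: zb n.

Definition ytrial (n : nat) (t : R) : 'rV[R]_p :=
  prox (beta * t) (fconj f) (ymd n + (beta * t) *: grady (x n) (y n.-1)).

(* theta, Phiy and rterm take a candidate v for y n, since they are evaluated
   at every trial point of the linesearch. *)
Definition theta (n : nat) (v : 'rV[R]_p) : 'rV[R]_q :=
  gradx (x n) v - gradx (x n.-1) (y n.-1).

Definition Phiy (n : nat) (v : 'rV[R]_p) : R :=
  Phi (x n) (y n.-1) + dotv (grady (x n) (y n.-1)) (v - y n.-1) - Phi (x n) v.

Definition rterm (n : nat) (v : 'rV[R]_p) : R :=
  omega1 P * delta n.-1 * enorm (x n - x n.-1) ^+ 2
  + b / beta * enorm (v - y n.-1) ^+ 2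
  + beta^-1 * (1 - b) * (1 + b) * enorm (v - zb n) ^+ 2.

Definition rseq (n : nat) : R := rterm n (y n).

Definition window (n : nat) : seq nat :=
  index_iota (maxn (n - par_M P) 1) n.

Definition cseq (n : nat) : R :=
  if (n <= 1)%N then 0
  else par_eta P / (size (window n))%:R * \sum_(i <- window n) rseq i.

Definition accept (n : nat) (t : R) : Prop :=
  let v := ytrial n t in
  t * tau n.-1 / ((1 - a) * par_xi P) * enorm (theta n v) ^+ 2
  + 2 * t * Phiy n v
  <= par_nu P * rterm n v + (1 - par_nu P) * cseq n.

Definition tau_init (n : nat) : R :=
  Num.min (par_phi P * tau n.-1) (par_taumax P).

Definition linesearch (n : nat) : Prop :=
  exists i : nat,
    [/\ tau n = tau_init n * par_mu P ^+ i,
        accept n (tau n) &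
        forall j : nat, (j < i)%N -> ~ accept n (tau_init n * par_mu P ^+ j)].

Definition npdal_init : Prop :=
  [/\ edom g (x 0%N), edom (fconj f) (y 0%N), z 0%N = x 0%N, zb 0%N = y 0%N &
      tau 0%N = par_tau0 P /\ delta 0%N = par_delta0 P].

Record npdal_step (n : nat) : Prop := NPDALStep {
  step_z : z n = ((psi - 1) / psi) *: x n.-1 + psi^-1 *: z n.-1;
  step_x : x n = prox (tau n.-1) g
                   (xmd n - tau n.-1 *: gradx (x n.-1) (y n.-1));
  step_zb : zb n = (1 - b) *: y n.-1 + b *: zb n.-1;
  step_tau : linesearch n;
  step_y : y n = ytrial n (tau n);
  step_delta : delta n = tau n / tau n.-1 }.

Definition npdal_generated : Prop :=
  npdal_init /\ (forall n : nat, (1 <= n)%N -> npdal_step n).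

Definition stepsum (N : nat) : R := \sum_(1 <= n < N.+1) tau n.

Definition xhat (N : nat) : 'rV[R]_q :=
  (stepsum N)^-1 *: \sum_(1 <= n < N.+1) tau n *: x n.

Definition yhat (N : nat) : 'rV[R]_p :=
  (stepsum N)^-1 *: \sum_(1 <= n < N.+1) tau n *: y n.

End Algorithm.

(* Main.v *)
Require Import Defs.
From mathcomp Require Import all_boot all_order all_algebra finmap.
From mathcomp Require Import boolp classical_sets functions reals ereal.
From mathcomp Require Import interval_inference topology normedtype convex.
From mathcomp Require Import ring lra.
Import Order.TTheory GRing.Theory Num.Theory.
Import numFieldNormedType.Exports.

Set Implicit Arguments.
Unset Strict Implicit.
Unset Printing Implicit Defensive.

Local Open Scope classical_set_scope.
Local Open Scope ring_scope.

(** The optimality conditions of the three proximal points (x_n, x_(n+1) and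
    y_n) and the gradient inequalities of Phi give, with the linesearch test,
      2 tau_n J(x_n, y_n) + E_(n+1) <= E_n - (1 - nu) r_n + (1 - nu) c_n
    for an energy E_n >= 0.  The c_n are window averages of eta times past
    r_i, so their sum exceeds that of the r_n by at most a constant; hence
    sum tau_n J(x_n, y_n) is bounded and so are the iterates.  All trial points
    of the linesearch are then bounded too, the Lipschitz constants of the
    gradients become uniform, and every step size below a fixed threshold is
    accepted; so tau_n is bounded away from 0 and s_N grows linearly.  Jensen's
    inequality for the convex functions L(-, ys) and - L(xs, -) concludes. *)

(** * Euclidean norm *)

(** The order of the argument is forced by the local nature of the Lipschitz constants. They exist
    only on bounded sets, so boundedness has to come from the summed energy inequality, which takes
    the linesearch test as given and needs no lower bound on the step sizes. Once bounds hold, the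
    test might still become harder to pass as the ratios [delta] shrink, since they weight the
    primal part of r_n. But the theta term of the test carries the factor tau_(n-1), and delta_(n-1)
    >= m tau_(n-1) for a fixed m > 0, so this factor cancels and the acceptance threshold does not
    depend on n. *)

Section Euclidean.
Context {R : realType} {n : nat}.
Implicit Types (u v w : 'rV[R]_n).

Lemma dotvC u v : dotv u v = dotv v u.
Proof. by apply: eq_bigr => i _; rewrite mulrC. Qed.

Lemma dotvDl u v w : dotv (u + v) w = dotv u w + dotv v w.
Proof. by rewrite /dotv -big_split; apply: eq_bigr => i _; rewrite !mxE mulrDl. Qed.

Lemma dotvZl (c : R) u w : dotv (c *: u) w = c * dotv u w.
Proof. by rewrite /dotv mulr_sumr; apply: eq_bigr => i _; rewrite !mxE mulrA. Qed.

Lemma dotvNl u w : dotv (- u) w = - dotv u w.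
Proof. by rewrite -scaleN1r dotvZl mulN1r. Qed.

Lemma dotvDr u v w : dotv w (u + v) = dotv w u + dotv w v.
Proof. by rewrite !(dotvC w) dotvDl. Qed.

Lemma dotvZr (c : R) u w : dotv w (c *: u) = c * dotv w u.
Proof. by rewrite !(dotvC w) dotvZl. Qed.

Lemma dotvNr u w : dotv w (- u) = - dotv w u.
Proof. by rewrite !(dotvC w) dotvNl. Qed.

Definition dotvE := (dotvDl, dotvDr, dotvNl, dotvNr, dotvZl, dotvZr).

Lemma dotv_ge0 u : 0 <= dotv u u.
Proof. by apply: sumr_ge0 => i _; rewrite -expr2 sqr_ge0. Qed.

Lemma enorm_ge0 u : 0 <= enorm u.
Proof. exact: sqrtr_ge0. Qed.

Lemma sqr_enorm u : enorm u ^+ 2 = dotv u u.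
Proof. by rewrite sqr_sqrtr // dotv_ge0. Qed.

Lemma dotv_eq0 u : dotv u u = 0 -> u = 0.
Proof.
move=> /eqP; rewrite psumr_eq0 => [/allP uu0|i _]; last by rewrite -expr2 sqr_ge0.
apply/rowP => i; rewrite mxE; have := uu0 i (mem_index_enum i).
by rewrite /= mulf_eq0 orbb => /eqP.
Qed.

Lemma enorm_gt0 u : u != 0 -> 0 < enorm u.
Proof.
move=> u0; rewrite lt_def enorm_ge0 andbT; apply: contra_neq u0 => e0.
by apply: dotv_eq0; rewrite -sqr_enorm e0 expr0n.
Qed.

Lemma enormN u : enorm (- u) = enorm u.
Proof. by rewrite /enorm dotvNl dotvNr opprK. Qed.

Lemma enormC u v : enorm (u - v) = enorm (v - u).
Proof. by rewrite -enormN opprB. Qed.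

Lemma enormZ (c : R) u : enorm (c *: u) = `|c| * enorm u.
Proof. by rewrite /enorm dotvZl dotvZr mulrA -expr2 sqrtrM ?sqr_ge0 // sqrtr_sqr. Qed.

Lemma cauchy_schwarz u v : dotv u v <= enorm u * enorm v.
Proof.
have [->|v0] := eqVneq v 0.
  by rewrite -{1}(scale0r 0) dotvZr mul0r mulr_ge0 ?enorm_ge0.
have [->|u0] := eqVneq u 0.
  by rewrite -{1}(scale0r 0) dotvZl mul0r mulr_ge0 ?enorm_ge0.
have := dotv_ge0 (enorm v *: u - enorm u *: v).
rewrite !dotvE (dotvC v u) -!sqr_enorm.
rewrite [X in 0 <= X -> _](_ : _ =
  2 * (enorm u * enorm v) * (enorm u * enorm v - dotv u v)); last by ring.
by rewrite pmulr_rge0 ?subr_ge0 // !mulr_gt0 ?enorm_gt0.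
Qed.

Lemma enormD u v : enorm (u + v) <= enorm u + enorm v.
Proof.
rewrite -(@ler_pXn2r _ 2) ?nnegrE ?addr_ge0 ?enorm_ge0 //.
rewrite sqrrD !sqr_enorm !dotvE (dotvC v u) -!sqr_enorm.
have := cauchy_schwarz u v; lra.
Qed.

Lemma ler_norm_enorm u : `|u| <= enorm u.
Proof.
rewrite [leLHS]/Num.norm /= mx_normrE; apply: bigmax_le => [|[i j] _ /=]; first exact: enorm_ge0.
rewrite -(@ler_pXn2r _ 2) ?nnegrE ?enorm_ge0 // sqr_enorm real_normK ?num_real //.
rewrite (ord1 i) /dotv (bigD1 j) //= -expr2 lerDl.
by apply: sumr_ge0 => k _; rewrite -expr2 sqr_ge0.
Qed.

Lemma enorm_bounded_set (M : R) : bounded_set [set u : 'rV[R]_n | enorm u <= M].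
Proof.
exists M; split; first exact: num_real.
move=> x Mx u /= uM; apply: le_trans (ler_norm_enorm u) _.
exact: le_trans uM (ltW Mx).
Qed.

Lemma sqr_enorm_continuous u : (fun w => enorm w ^+ 2) @ u --> enorm u ^+ 2.
Proof.
pose S (s : seq 'I_n) (w : 'rV[R]_n) : R := \sum_(i <- s) w ord0 i * w ord0 i.
suff H s : S s @ u --> S s u.
  rewrite sqr_enorm [X in X @ _ --> _](_ : _ = S (index_enum _)); first exact: H.
  by apply/funext => w; rewrite sqr_enorm.
elim: s => [|i s IH].
  have -> : S [::] = fun=> 0 by apply/funext => w; rewrite /S big_nil.
  exact: cst_continuous.
have -> : S (i :: s) = fun w => w ord0 i * w ord0 i + S s w.
  by apply/funext => w; rewrite /S big_cons.
by apply: (@cvgD _ _ _ (nbhs u)) => //; apply: (@cvgM _ _ (nbhs u)); exact: coord_continuous.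
Qed.

End Euclidean.

(** * Convex functions and proximal points *)

(** Removes the second-order term of a first-order condition: after a move by a fraction t towards a
    test point and division by t, only a multiple of t is left on the right. *)
Lemma ler0_of_small {R : realFieldType} (A B : R) :
  (forall t : R, 0 < t -> t < 1 -> A <= t * B) -> A <= 0.
Proof.
move=> AB; apply/ler_addgt0Pr => e e0; rewrite add0r.
pose t := Num.min (1 / 2) (e / (`|B| + 1)).
have B1 : 0 < `|B| + 1 by rewrite ltr_wpDl.
have t0 : 0 < t by rewrite /t lt_min !divr_gt0.
have t1 : t < 1 by rewrite /t gt_min; apply/orP; left; lra.
apply: le_trans (AB t t0 t1) _.
have te : t <= e / (`|B| + 1) by rewrite /t ge_min lexx orbT.
apply: le_trans (_ : t * (`|B| + 1) <= _); last by rewrite -ler_pdivlMr.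
by rewrite ler_pM2l // (le_trans (ler_norm B)) // lerDl.
Qed.

(** If no point were minimal, the open sets where h > h w, for w in K with h w finite, would cover
    K. The least h w of a finite subcover is attained at a point that the subcover misses. Only
    finite values are used because lower semicontinuity gives openness for real thresholds. *)
Lemma lsc_compact_argmin {R : realType} {T : ptopologicalType} (h : T -> \bar R)
    (K : set T) :
  compact K -> K !=set0 -> lower_semicontinuous h -> (forall x, h x != -oo%E) ->
  exists2 u, K u & forall w, K w -> (h u <= h w)%E.
Proof.
move=> cK K0 lsc hNy; apply: contrapT => nomin.
have lt_ex x : K x -> exists2 w, K w & (h w < h x)%E.
  move=> Kx; apply: contrapT => nw; apply: nomin; exists x => // w Kw.
  by rewrite leNgt; apply/negP => hwx; apply: nw; exists w.
move: cK; rewrite compact_cover => /(_ T [set w | K w /\ h w \is a fin_num]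
  (fun w => [set u | (h w < h u)%E])) [w [Kw hw]| x Kx |D' D'K covD'].
- by rewrite -(fineK hw); apply/(lower_semicontinuousP h).1.
- have [w Kw hwx] := lt_ex _ Kx; exists w => //; split => //.
  by rewrite fin_numE hNy /= lt_eqF // (lt_le_trans hwx) // leey.
have [x0 Kx0] := K0; have [w0 D'w0 _] := covD' _ Kx0.
have [i _ imin] := arg_minP (fun i : D' => h (val i)) (isT : xpredT (FSetSub D'w0)).
have /D'K : val i \in D' by exact: valP.
rewrite inE => -[Ki _]; have [j D'j] := covD' _ Ki; rewrite /= ltNge => /negP; apply.
exact: (imin (FSetSub D'j) isT).
Qed.

Section ConvexFunctions.
Context {R : realType} {n : nat}.
Variable h : 'rV[R]_n -> \bar R.
Hypothesis hh : proper_closed_convex h.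
Implicit Types u v w x : 'rV[R]_n.

Lemma edom_fin u : edom h u -> h u = (fine (h u))%:E.
Proof.
case: hh => -[hNy _] _ _ hu; rewrite fineK // fin_numE hNy.
by rewrite (lt_eqF hu).
Qed.

Lemma edom_convex u w t : 0 < t -> t < 1 -> edom h u -> edom h w ->
  edom h (t *: u + (1 - t) *: w)
  /\ fine (h (t *: u + (1 - t) *: w)) <= t * fine (h u) + (1 - t) * fine (h w).
Proof.
move=> t0 t1 hu hw; have [_ _ /(_ u w t t0 t1)] := hh.
rewrite (edom_fin hu) (edom_fin hw) -!EFinM -EFinD => H.
have D : edom h (t *: u + (1 - t) *: w) by apply: le_lt_trans H (ltry _).
by split=> //; move: H; rewrite (edom_fin D) lee_fin.
Qed.

Lemma compact_norm_ball u r : compact [set w : 'rV[R]_n | `|w - u| <= r].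
Proof.
apply: bounded_closed_compact.
  exists (r + `|u|); split; first exact: num_real.
  move=> M rM w /= wr; apply: le_trans (ltW rM).
  by rewrite -{1}(subrK u w) (le_trans (ler_normD _ _)) // lerD2r.
rewrite (_ : [set w | _] = closed_ball_ Num.norm u r); first exact: closed_closed_ball_.
by apply/seteqP; split => w /=; rewrite distrC.
Qed.

(* If h >= a on the unit ball around u0, convexity along the ray from u0
   through u bounds h u below by an affine function of |u - u0|. *)
Lemma affine_minorant : exists A B : R, [/\ 0 <= A, 0 <= B &
  forall u, edom h u -> - (A + B * enorm u) <= fine (h u)].
Proof.
have [[hNy [u0 hu0]] lsc _] := hh.
have K0 : [set w : 'rV[R]_n | `|w - u0| <= 1] u0 by rewrite /= subrr normr0.
have [m Km mmin] := lsc_compact_argmin (@compact_norm_ball u0 1) (ex_intro _ u0 K0) lsc hNy.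
have hm : edom h m by apply: le_lt_trans hu0; exact: mmin.
set a := fine (h m); set b := fine (h u0).
have ab : a <= b by have := mmin _ K0; rewrite (edom_fin hu0) (edom_fin hm) lee_fin.
have amin w : edom h w -> `|w - u0| <= 1 -> a <= fine (h w).
  by move=> hw /mmin; rewrite (edom_fin hw) (edom_fin hm) lee_fin.
exists (`|a| + (b - a) * enorm u0), (b - a); rewrite subr_ge0; split => //.
  by rewrite addr_ge0 // mulr_ge0 ?subr_ge0 ?enorm_ge0.
move=> u hu; apply: le_trans (_ : a - (b - a) * enorm (u - u0) <= _).
  have := ler_norm (- a); rewrite normrN => aa.
  have : (b - a) * enorm (u - u0) <= (b - a) * (enorm u + enorm u0).
    apply: ler_wpM2l; first by rewrite subr_ge0.
    by rewrite -(enormN u0) enormD.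
  lra.
have := ler_norm_enorm (u - u0).
have [u1|u1] := leP `|u - u0| 1; set e := enorm _ => ue.
  apply: le_trans (amin _ hu u1).
  by rewrite gerBl mulr_ge0 ?subr_ge0 ?enorm_ge0.
set r := `|u - u0| in u1 ue.
have r0 : 0 < r by lra.
have rV1 : r^-1 < 1 by rewrite invf_lt1.
have rV0 : 0 < r^-1 by rewrite invr_gt0.
have [hw] := edom_convex rV0 rV1 hu hu0.
have /(amin _ hw) : `|r^-1 *: u + (1 - r^-1) *: u0 - u0| <= 1.
  have -> : r^-1 *: u + (1 - r^-1) *: u0 - u0 = r^-1 *: (u - u0).
    by apply/rowP => i; rewrite !mxE; ring.
  by rewrite normrZ gtr0_norm // mulVf ?gt_eqF.
rewrite -/b => H1 H2; have := le_trans H1 H2.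
rewrite -(ler_pM2l r0) mulrDr !mulrA mulrBr mulr1 mulfV ?gt_eqF // mul1r => H.
have : (b - a) * r <= (b - a) * e by rewrite ler_wpM2l ?subr_ge0.
nra.
Qed.

Variables (lam : R) (lam_gt0 : 0 < lam).
Let c := (2 * lam)^-1.
Let c_gt0 : 0 < c. Proof. by rewrite invr_gt0 mulr_gt0. Qed.
Let F x u := (h u + (c * enorm (u - x) ^+ 2)%:E)%E.

Let lscF x : lower_semicontinuous (F x).
Proof.
have [[hNy _] lsc _] := hh.
pose s u : R := c * enorm (u - x) ^+ 2.
have s_cont u : s @ u --> s u.
  apply: (@cvgM _ _ (nbhs u)); first exact: cst_continuous.
  apply: (@continuous_comp _ _ _ (fun w => w - x) (fun w => enorm w ^+ 2) u).
    by apply: (@continuousB _ _ _ id (fun=> x)); [move=> ?; exact: cvg_id | exact: cst_continuous].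
  exact: sqr_enorm_continuous.
move=> u a; rewrite /F -/(s u) => au.
(* The threshold a is split: b lies below h u and a - b below s u. When h u is infinite, any b above
   a - s u serves. *)
have [b [bh ab]] : exists b, (b%:E < h u)%E /\ a - s u < b.
  move: au; case E : (h u) (hNy u) => [r| |] // _.
    rewrite -EFinD lte_fin => au; exists ((r + (a - s u)) / 2); rewrite lte_fin; split; lra.
  by move=> _; exists (a - s u + 1); rewrite ltry; split => //; lra.
have [V nV Vb] := lsc u b bh.
have nW : nbhs u [set w | a - b < s w].
  apply: (s_cont u [set r | a - b < r]); apply: open_nbhs_nbhs.
  by split; [exact: open_gt | rewrite /=; lra].
exists (V `&` [set w | a - b < s w]); first exact: filterI.
move=> w [/Vb bw /= sw]; rewrite -/(s w).
apply: lt_trans (_ : ((b + s w)%:E < _)%E); first by rewrite lte_fin; lra.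
by rewrite EFinD lteD2rE.
Qed.

(** [prox] is a choice with default 0, so a minimizer has to be exhibited. The quadratic term
    outgrows the affine minorant, hence points outside a large ball are worse than u0, and the
    minimum over the compact ball is global. *)
Lemma prox_argmin x : argmin (F x) (prox lam h x).
Proof.
suff [u Pu] : exists u, argmin (F x) u by exact: (xgetPex 0 (ex_intro _ u Pu)).
have [[hNy [u0 hu0]] lsc _] := hh.
have [A [B [A0 B0 AB]]] := affine_minorant.
have FNy u : F x u != -oo%E.
  by rewrite /F; move: (hNy u); case: (h u).
pose T := `|A + B * enorm x + (fine (h u0) + c * enorm (u0 - x) ^+ 2)| + 1.
have T1 : 1 <= T by rewrite /T lerDr.
(* For e >= r this gives c e >= B + T and e >= 1, hence c e^2 - B e >= e T >= T, while T exceeds A +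
   B [enorm x] + F x u0. *)
pose r := 1 + (B + T) / c.
have r1 : 1 <= r by rewrite /r lerDl divr_ge0 ?(ltW c_gt0) //; lra.
have far u : r < `|u - x| -> (F x u0 < F x u)%E.
  move=> ru; have {ru} := lt_le_trans ru (ler_norm_enorm (u - x)).
  set e := enorm _ => re; rewrite {2}/F -/e.
  have [hu|hu] := ltP (h u) +oo%E; last first.
    move: hu; rewrite leye_eq => /eqP ->; rewrite addye //.
    by rewrite /F (edom_fin hu0) -EFinD ltry.
  rewrite /F (edom_fin hu0) (edom_fin hu) -!EFinD lte_fin.
  have := AB _ hu; have : enorm u <= e + enorm x.
    by rewrite -{1}(subrK x u) enormD.
  move=> /(ler_wpM2l B0) ue uAB.
  have cr : B + T <= c * e.
    rewrite mulrC -ler_pdivrMr //; apply: le_trans (ltW re).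
    by rewrite /r; lra.
  have e1 : 1 <= e by lra.
  have : T < c * e ^+ 2 - B * e + 1.
    have : 0 <= e * (c * e - B - T) by rewrite mulr_ge0; lra.
    have : T <= e * T by rewrite ler_peMl //; lra.
    lra.
  have := ler_norm (A + B * enorm x + (fine (h u0) + c * enorm (u0 - x) ^+ 2)).
  rewrite /T; lra.
have Ku0 : `|u0 - x| <= r.
  by rewrite leNgt; apply/negP => /far; rewrite ltxx.
have [u Ku umin] := lsc_compact_argmin (@compact_norm_ball x r)
  (ex_intro _ u0 Ku0) (@lscF x) FNy.
exists u => w; have [wr|wr] := leP `|w - x| r; first exact: umin.
exact: le_trans (umin _ Ku0) (ltW (far _ wr)).
Qed.

Lemma prox_edom x : edom h (prox lam h x).
Proof.
have [[hNy [u0 hu0]] _ _] := hh.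
have := prox_argmin x u0; rewrite /F (edom_fin hu0) -EFinD => H.
rewrite /edom /= ltNge leye_eq; apply/negP => /eqP E; move: H.
by rewrite E addye // leNgt ltry.
Qed.

(** Compare u with t w + (1 - t) u: convexity bounds the change of h by a multiple of t, while the
    quadratic changes by a linear term plus O(t^2). Divide by t and let t tend to 0. *)
Lemma prox_ineq x w : edom h w ->
  lam * (fine (h (prox lam h x)) - fine (h w)) <=
    dotv (prox lam h x - x) (w - prox lam h x).
Proof.
move=> hw; set u := prox lam h x.
have hu : edom h u := prox_edom x.
have cE : c = 2^-1 / lam by rewrite /c invfM.
rewrite -subr_le0; apply: (@ler0_of_small _ _ (enorm (w - u) ^+ 2 / 2)) => t t0 t1.
have [hv hvle] := edom_convex t0 t1 hw hu.
have := prox_argmin x (t *: w + (1 - t) *: u).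
rewrite -/u /F (edom_fin hv) (edom_fin hu) -!EFinD lee_fin.
have -> : t *: w + (1 - t) *: u - x = (u - x) + t *: (w - u).
  by apply/rowP => i; rewrite !mxE; ring.
rewrite !sqr_enorm !(dotvDl (u - x)) !(dotvDr (u - x)) !dotvZl !dotvZr.
rewrite (dotvC (w - u) (u - x)).
set d := dotv (u - x) (w - u); set e := dotv (w - u) (w - u).
set k := dotv _ _; move: hvle; set fu := fine (h u); set fw := fine (h w).
set fv := fine _ => hvle H.
have {H hvle} : t * (fu - fw) <= c * (2 * t * d + t ^+ 2 * e).
  by clearbody c fu fw fv k d e; lra.
have -> : c * (2 * t * d + t ^+ 2 * e) = t * ((d + t * e / 2) / lam).
  by rewrite cE; field; rewrite gt_eqF.
rewrite ler_pM2l // ler_pdivlMr //= -/fu; clearbody fu fw d e; lra.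
Qed.

End ConvexFunctions.

(** * Conjugates, gradient inequalities and Jensen's inequality *)

Section MoreConvexity.
Context {R : realType} {n : nat}.
Implicit Types (u v w x y : 'rV[R]_n) (D : set 'rV[R]_n) (k : 'rV[R]_n -> R).

Lemma dotv_continuous x y : (dotv x) @ y --> dotv x y.
Proof.
have -> : dotv x = fun w => 2^-1 * (enorm (w - - x) ^+ 2 - enorm w ^+ 2 - enorm x ^+ 2).
  by apply/funext => w; rewrite opprK !sqr_enorm !dotvE (dotvC w x); field.
apply: (@cvgM _ _ (nbhs y)); first exact: cst_continuous.
apply: (@cvgB _ _ _ (nbhs y)); last exact: cst_continuous.
apply: (@cvgB _ _ _ (nbhs y)); last exact: sqr_enorm_continuous.
apply: (@continuous_comp _ _ _ (fun w => w - - x) (fun w => enorm w ^+ 2) y).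
  by apply: (@continuousB _ _ _ id (fun=> - x)); [move=> ?; exact: cvg_id | exact: cst_continuous].
exact: sqr_enorm_continuous.
Qed.

(** The conjugate is a supremum of affine functions, hence closed and convex, and a point where f is
    finite keeps it above -oo. The nonempty domain is later supplied by the saddle point. *)
Lemma fconj_pcc (f : 'rV[R]_n -> \bar R) :
  Defs.proper f -> edom (fconj f) !=set0 -> proper_closed_convex (fconj f).
Proof.
move=> [fNy [x0 fx0]] dom0.
have fconj_ub x y : ((dotv x y)%:E - f x <= fconj f y)%E.
  by apply: ereal_sup_ubound; exists x.
have FNy y : fconj f y != -oo%E.
  apply/eqP => FE; have := fconj_ub x0 y; rewrite FE leeNy_eq.
  by move: (fNy x0) fx0; rewrite /edom /=; case: (f x0).
split=> [//| y a | y y' t t0 t1].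
  move=> /ereal_sup_gt[_ [x _ <-]].
  move: (fNy x); case fx : (f x) => [r| |] // _.
  rewrite -EFinB lte_fin => ar.
  exists [set w | a + r < dotv x w].
    have /= := @dotv_continuous x y [set s | a + r < s]; apply.
    by apply: open_nbhs_nbhs; split; [exact: open_gt | rewrite /=; lra].
  move=> w /= aw; apply: lt_le_trans (fconj_ub x w).
  by rewrite fx -EFinB lte_fin; lra.
apply: ge_ereal_sup => _ [x _ <-].
move: (fNy x) (fconj_ub x y) (fconj_ub x y').
case fx : (f x) => [r| |] // _; last by move=> _ _; exact: leNye.
case: (fconj f y) (FNy y) => [s| |] // _; case: (fconj f y') (FNy y') => [s'| |] // _;
  rewrite -?EFinB ?lee_fin.
- rewrite dotvDr !dotvZr => H1 H2.
  have : t * (dotv x y - r) <= t * s by rewrite ler_pM2l.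
  have : (1 - t) * (dotv x y' - r) <= (1 - t) * s' by rewrite ler_pM2l ?subr_gt0.
  lra.
- by move=> _ _; rewrite [X in (_ + X)%E]gt0_muley ?lte_fin ?subr_gt0 // addey ?leey.
- by move=> _ _; rewrite gt0_muley ?lte_fin // addye ?leey.
- by move=> _ _; rewrite !gt0_muley ?lte_fin ?subr_gt0 // addye ?leey.
Qed.

Lemma convex_function_ineq D k u w t : convex_function D k ->
  0 < t -> t < 1 -> D u -> D w ->
  k (t *: u + (1 - t) *: w) <= t * k u + (1 - t) * k w.
Proof.
move=> ck t0 t1 Du Dw.
exact: (ck (Itv01 (ltW t0) (ltW t1)) u w (mem_set Du) (mem_set Dw)).
Qed.

(** By convexity the difference quotients along the segment from x to w are at most k w - k x. The
    segment stays in D, so the limit within D applies although D need not be open. *)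
Lemma gradient_ineq D k x v w :
  (forall t : R, 0 < t -> t < 1 -> D (t *: w + (1 - t) *: x)) ->
  convex_function D k -> D x -> D w -> is_gradient D k x v ->
  dotv v (w - x) <= k w - k x.
Proof.
move=> convD ck Dx Dw grad.
have [->|wx] := eqVneq w x.
  by rewrite !subrr -(scale0r 0) dotvZr mul0r.
have d0 : w - x != 0 by rewrite subr_eq0.
have e0 := enorm_gt0 d0; set d := w - x in d0 e0 *.
rewrite -subr_le0 -(@ler_pM2l _ (enorm d)^-1) ?invr_gt0 // mulr0.
apply/ler_addgt0Pr => eps eps0; rewrite add0r.
have := grad _ (nbhsx_ballx (0 : R) eps eps0).
rewrite /within /= => /nbhs_ballP[r /= r0 Br].
have dn0 : 0 < `|d| by rewrite normr_gt0.
pose t := Num.min (1 / 2) (r / (2 * `|d|)).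
have t0 : 0 < t by rewrite /t lt_min !divr_gt0 ?mulr_gt0.
have t1 : t < 1 by rewrite /t gt_min; apply/orP; left; lra.
have tr : t * `|d| < r.
  rewrite -ltr_pdivlMr // /t gt_min; apply/orP; right.
  rewrite ltr_pdivrMr ?mulr_gt0 // (_ : _ / _ * _ = 2 * r); first by lra.
  by field; rewrite gt_eqF.
have uE : t *: w + (1 - t) *: x = x + t *: d.
  by apply/rowP => i; rewrite !mxE; ring.
have uxE : t *: w + (1 - t) *: x - x = t *: d by rewrite uE addrC addKr.
have := Br (t *: w + (1 - t) *: x).
rewrite -!ball_normE /= distrC uxE normrZ gtr0_norm // => /(_ tr).
rewrite -subr_eq0 uxE scaler_eq0 gt_eqF //= d0 => /(_ isT (convD t t0 t1)).
rewrite sub0r normrN dotvZr enormZ (gtr0_norm t0).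
rewrite ltr_norml => /andP[+ _].
have := convex_function_ineq ck t0 t1 Dw Dx; set ku := k _ => H.
rewrite ltr_pdivlMr ?mulr_gt0 // => H2.
rewrite mulrC ler_pdivrMr // -(ler_pM2l t0).
lra.
Qed.

(** Induction on N merges the normalized average so far with the next point, with weights
    proportional to s and the new tau. Membership in D and the inequality go together because the
    two-point inequality is available only on D. *)
Lemma weighted_jensen D k (x : nat -> 'rV[R]_n) (tau : nat -> R) N :
  (forall u w (t : R), 0 < t -> t < 1 -> D u -> D w ->
    D (t *: u + (1 - t) *: w) /\
    k (t *: u + (1 - t) *: w) <= t * k u + (1 - t) * k w) ->
  (forall i, (1 <= i)%N -> D (x i)) -> (forall i, (1 <= i)%N -> 0 < tau i) ->
  (1 <= N)%N ->
  let s := \sum_(1 <= i < N.+1) tau i in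
  let xh := s^-1 *: \sum_(1 <= i < N.+1) tau i *: x i in
  [/\ 0 < s, D xh & s * k xh <= \sum_(1 <= i < N.+1) tau i * k (x i)].
Proof.
move=> conv Dx tau0; elim: N => // -[_ _|N IH _] /=.
  rewrite !big_nat1 scalerA mulVf ?scale1r ?gt_eqF ?tau0 //. by split => //; exact: Dx.
have rec (V : nmodType) (F : nat -> V) :
    \sum_(1 <= i < N.+3) F i = \sum_(1 <= i < N.+2) F i + F N.+2.
  by rewrite big_nat_recr.
have /= := IH isT; rewrite !rec => -[].
move: (\sum_(1 <= i < N.+2) tau i) (\sum_(1 <= i < N.+2) tau i *: x i)
  (\sum_(1 <= i < N.+2) tau i * k (x i)) => s X K s0 DX sK.
have tN : 0 < tau N.+2 by exact: tau0.
have sN : 0 < s + tau N.+2 by rewrite addr_gt0.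
pose t := s / (s + tau N.+2).
have t0 : 0 < t by rewrite divr_gt0.
have t1 : t < 1 by rewrite ltr_pdivrMr // mul1r ltrDl.
have [DC kC] := conv _ _ t t0 t1 DX (Dx N.+2 isT).
have -> : (s + tau N.+2)^-1 *: (X + tau N.+2 *: x N.+2) =
    t *: (s^-1 *: X) + (1 - t) *: x N.+2.
  apply/rowP => i; rewrite !mxE /t; field; by rewrite !gt_eqF.
split=> //; apply: le_trans (_ : s * k (s^-1 *: X) + tau N.+2 * k (x N.+2) <= _).
  move: kC; rewrite -(ler_pM2l sN) => /le_trans; apply.
  rewrite mulrDr !mulrA le_eqVlt; apply/orP; left; apply/eqP; congr (_ * _ + _ * _).
    by rewrite /t; field; rewrite gt_eqF.
  by rewrite /t; field; rewrite gt_eqF.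
by rewrite lerD2r.
Qed.
End MoreConvexity.

(** * Energy estimates *)

Section Descent.
Context {R : realType}.
Variables (P : npdal_params R) (hP : valid_params P).
Local Notation psi := (par_psi P).
Local Notation a := (par_a P).
Local Notation b := (par_b P).
Local Notation xi := (par_xi P).
Local Notation xi1 := (par_xi1 P).
Local Notation phi := (par_phi P).

(* The squared norms split over coordinates, so the vector estimate reduces to
   the scalar one, whose two sides differ by an explicit sum of squares.  The
   term psi^3 phi / (1 + psi) of omega1 comes from completing the first square. *)
Lemma primal_descent_coord (d t' X2 X1 X0 Z1 Z2 Z3 s th : R) :
  0 < d -> d <= phi -> 0 < t' ->
  Z2 = (psi - 1) / psi * X1 + psi^-1 * Z1 ->
  Z3 = (psi - 1) / psi * X2 + psi^-1 * Z2 ->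
  2 * ((X2 - (a * X1 + (1 - a) * Z2)) * (s - X2))
  + 2 * d * ((X1 - (a * X0 + (1 - a) * Z1)) * (X2 - X1))
  + 2 * (d * t') * (th * (X1 - X2))
  <= a * ((X1 - s) * (X1 - s)) + (1 - a) * psi / (psi - 1) * ((Z2 - s) * (Z2 - s))
     + a * ((X1 - X0) * (X1 - X0)) - a * ((X2 - s) * (X2 - s))
     - (1 - a) * psi / (psi - 1) * ((Z3 - s) * (Z3 - s))
     - a * ((X2 - X1) * (X2 - X1)) - omega1 P * d * ((X2 - X1) * (X2 - X1))
     + d * t' * t' / ((1 - a) * xi) * (th * th).
Proof.
move=> d0 dphi t'0 Z2E Z3E.
have /andP[psi1 _] := vp_psi hP; have /andP[a0 a1] := vp_a hP.
have xi0 := vp_xi hP; have /andP[phi1 _] := vp_phi hP.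
have /andP[xi10 xi1phi] := vp_xi1 hP.
(* The condition xi1 < 1 / phi makes the coefficient of (X1 - X0)^2 below nonnegative. *)
have dxi1 : d * xi1 <= 1.
  apply: le_trans (_ : phi * xi1 <= _); first by rewrite ler_pM2r.
  by rewrite mulrC -ler_pdivlMr ?div1r ?ltW //; lra.
have psi0 : 0 < psi by lra.
have psi11 : 0 < 1 + psi by lra.
(* Young's inequality with weight [xi1] absorbs the product of consecutive increments and accounts
   for the summand - a / xi1 of [omega1]. The one with weight [xi] absorbs the product of th with
   the increment and accounts for - (1 - a) xi. *)
rewrite -subr_ge0 [leRHS](_ : _ =
  (1 - a) * (1 + psi^-1) * ((X2 - Z2) - d * psi ^+ 2 / (1 + psi) * (X2 - X1)) ^+ 2
  + (1 - a) * d * (phi - d) * psi ^+ 3 / (1 + psi) * (X2 - X1) ^+ 2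
  + a * d * xi1 * ((X1 - X0) - (X2 - X1) / xi1) ^+ 2
  + a * (1 - d * xi1) * (X1 - X0) ^+ 2
  + d * t' * t' / ((1 - a) * xi) * (th + (1 - a) * xi / t' * (X2 - X1)) ^+ 2).
  have a10 : 0 <= 1 - a by lra.
  have pd : 0 <= phi - d by lra.
  have dx : 0 <= 1 - d * xi1 by lra.
  have pV : 0 <= psi^-1 by rewrite invr_ge0 ltW.
  have psi30 : 0 <= psi ^+ 3 by rewrite exprn_ge0 ?ltW.
  have := (ltW d0, ltW t'0, ltW a0, ltW xi10, ltW psi11, ltW xi0).
  move=> [[[[[H1 H2] H3] H4] H5] H6].
  by repeat first [assumption | exact: ler01 | exact: sqr_ge0 | apply: addr_ge0
                  | apply: divr_ge0 | apply: mulr_ge0].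
rewrite Z3E Z2E /omega1; field.
by rewrite !gt_eqF //; lra.
Qed.

Lemma primal_descent n (X2 X1 X0 Z1 Z2 Z3 s th : 'rV[R]_n) (d t' : R) :
  0 < d -> d <= phi -> 0 < t' ->
  Z2 = ((psi - 1) / psi) *: X1 + psi^-1 *: Z1 ->
  Z3 = ((psi - 1) / psi) *: X2 + psi^-1 *: Z2 ->
  2 * dotv (X2 - (a *: X1 + (1 - a) *: Z2)) (s - X2)
  + 2 * d * dotv (X1 - (a *: X0 + (1 - a) *: Z1)) (X2 - X1)
  + 2 * (d * t') * dotv th (X1 - X2)
  <= a * enorm (X1 - s) ^+ 2 + (1 - a) * psi / (psi - 1) * enorm (Z2 - s) ^+ 2
     + a * enorm (X1 - X0) ^+ 2 - a * enorm (X2 - s) ^+ 2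
     - (1 - a) * psi / (psi - 1) * enorm (Z3 - s) ^+ 2
     - a * enorm (X2 - X1) ^+ 2 - omega1 P * d * enorm (X2 - X1) ^+ 2
     + d * t' * t' / ((1 - a) * xi) * enorm th ^+ 2.
Proof.
move=> d0 dphi t'0 -> ->; rewrite !sqr_enorm /dotv !mulr_sumr -!sumrN -!big_split /=.
apply: ler_sum => i _; rewrite !mxE.
exact: primal_descent_coord d0 dphi t'0 erefl erefl.
Qed.

(** The recursion for V2 makes the distances to s telescope. The leftover terms are the dual part of
    [rterm] up to the factor 1 / beta, which explains its weights b and (1 - b)(1 + b). *)
Lemma dual_identity n (Y1 Y0 V1 V2 s : 'rV[R]_n) :
  V2 = (1 - b) *: Y1 + b *: V1 ->
  2 * dotv (Y1 - (b *: Y0 + (1 - b) *: V1)) (s - Y1)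
  = b * enorm (Y0 - s) ^+ 2 + enorm (V1 - s) ^+ 2 - b * enorm (Y1 - s) ^+ 2
    - enorm (V2 - s) ^+ 2 - b * enorm (Y1 - Y0) ^+ 2
    - (1 - b) * (1 + b) * enorm (Y1 - V1) ^+ 2.
Proof.
move=> ->; rewrite !sqr_enorm /dotv !mulr_sumr -!sumrN -!big_split /=.
by apply: eq_bigr => i _; rewrite !mxE; ring.
Qed.

End Descent.

(* For n > M the windows all have length M, so each r i is counted at most M
   times with weight eta / M; the indices n <= M only contribute a constant. *)
Lemma window_sum_bound {R : realFieldType} (r c : nat -> R) (eta : R) (M : nat) :
  0 <= eta -> eta <= 1 -> (1 <= M)%N -> (forall i, 0 <= r i) ->
  (forall n, 0 <= c n) ->
  (forall n, (M < n)%N -> c n = eta / M%:R * \sum_(n - M <= i < n) r i) ->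
  exists K, 0 <= K /\ forall N,
    \sum_(1 <= n < N.+1) c n <= K + \sum_(1 <= n < N.+1) r n.
Proof.
move=> eta0 eta1 M1 r0 c0 cE.
have sum0 m n (s : nat -> R) : (forall i, 0 <= s i) -> 0 <= \sum_(m <= i < n) s i.
  by move=> s0; apply: sumr_ge0.
exists (\sum_(1 <= n < M.+1) c n); split; first exact: sum0.
move=> N; have [NM|MN] := leqP N M.
  rewrite [X in _ <= X + _](@big_cat_nat _ _ _ N.+1) //= -addrA lerDl.
  by rewrite addr_ge0 // sum0.
rewrite (@big_cat_nat _ _ _ M.+1) //=; last by rewrite ltnS ltnW.
rewrite lerD2l.
have M0 : 0 < M%:R :> R by rewrite ltr0n.
set S := \sum_(1 <= n < N.+1) r n.
(* The sum over n is taken first: for a fixed offset j in the window, the indices j + (n - M) are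
   distinct and lie between 1 and N. *)
have inner j : (j < M)%N -> \sum_(M.+1 <= n < N.+1) r (j + (n - M))%N <= S.
  move=> jM.
  rewrite -[M.+1]add1n big_addn.
  under eq_bigr do rewrite addnK.
  have -> : \sum_(1 <= i < N.+1 - M) r (j + i)%N = \sum_(1 + j <= i < N.+1 - M + j) r i.
    by rewrite big_addn addnK; apply: eq_bigr => i _; rewrite addnC.
  have le1 : (1 <= 1 + j)%N by rewrite leq_addr.
  have le2 : (1 + j <= N.+1 - M + j)%N by rewrite leq_add2r subn_gt0 ltnS ltnW.
  have le3 : (N.+1 - M + j <= N.+1)%N.
    by rewrite addnBAC ?(leq_trans (ltnW MN)) // leq_subLR addnC leq_add2r ltnW.
  have le4 := leq_trans le2 le3.
  rewrite /S (big_cat_nat le1 le4) (big_cat_nat le2 le3) /=.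
  by rewrite [leRHS]addrCA lerDl addr_ge0 // sum0.
have -> : \sum_(M.+1 <= n < N.+1) c n =
    eta / M%:R * \sum_(0 <= j < M) \sum_(M.+1 <= n < N.+1) r (j + (n - M))%N.
  rewrite exchange_big_nat /= mulr_sumr.
  rewrite big_nat_cond [RHS]big_nat_cond; apply: eq_bigr => n /andP[/andP[Mn _] _].
  rewrite cE //; congr (_ * _); rewrite -{1}[(n - M)%N]add0n big_addn.
  by rewrite subKn // ltnW.
have : \sum_(0 <= j < M) \sum_(M.+1 <= n < N.+1) r (j + (n - M))%N <= M%:R * S.
  apply: le_trans (_ : \sum_(0 <= j < M) S <= _).
    by apply: ler_sum_nat => j /andP[_ jM]; exact: inner.
  by rewrite sumr_const_nat subn0 mulr_natl.
move=> /(ler_wpM2l (divr_ge0 eta0 (ltW M0))) /le_trans; apply.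
by rewrite mulrA divfK ?gt_eqF //; apply: ler_piMl => //; exact: sum0.
Qed.

(** * Saddle-point data *)

Lemma is_gradient_opp {R : realType} {n : nat} (D : set 'rV[R]_n) k x v :
  is_gradient D k x v -> is_gradient D (fun u => - k u) x (- v).
Proof.
rewrite /is_gradient => /cvgN; rewrite oppr0; apply: cvg_trans.
apply: near_eq_cvg; apply: nearW => u /=.
transitivity (- ((k u - k x - dotv v (u - x)) / enorm (u - x))) => //.
by rewrite dotvNl -mulNr; congr (_ / _); ring.
Qed.

Section SaddleData.
Context {R : realType} {q p : nat}.
Variables (g : 'rV[R]_q -> \bar R) (f : 'rV[R]_p -> \bar R).
Variable Phi : 'rV[R]_q -> 'rV[R]_p -> R.
Variables (gradx : 'rV[R]_q -> 'rV[R]_p -> 'rV[R]_q)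
          (grady : 'rV[R]_q -> 'rV[R]_p -> 'rV[R]_p).
Hypotheses (hg : proper_closed_convex g) (hF : proper_closed_convex (fconj f)).
Hypothesis hadm : admissible g f Phi gradx grady.
Variables (xs : 'rV[R]_q) (ys : 'rV[R]_p).
Hypothesis hs : saddle g f Phi (xs, ys).
Local Notation dg := (edom g).
Local Notation df := (edom (fconj f)).
Local Notation G x := (fine (g x)).
Local Notation F y := (fine (fconj f y)).

Lemma gradx_ineq x u y : dg x -> dg u -> df y ->
  dotv (gradx x y) (u - x) <= Phi u y - Phi x y.
Proof.
move=> gx gu fy; have [_ _ [_ /(_ y fy)[ck /(_ x gx) gr] _] _] := hadm.
by apply: (gradient_ineq _ ck gx gu gr) => t t0 t1; have [] := edom_convex hg t0 t1 gu gx.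
Qed.

Lemma grady_ineq x y v : dg x -> df y -> df v ->
  Phi x v - Phi x y <= dotv (grady x y) (v - y).
Proof.
move=> gx fy fv; have [_ _ [_ _ /(_ x gx)[ck /(_ y fy) gr]] _] := hadm.
have := gradient_ineq _ ck fy fv (is_gradient_opp gr).
have conv t : 0 < t -> t < 1 -> df (t *: v + (1 - t) *: y).
  by move=> t0 t1; have [] := edom_convex hF t0 t1 fv fy.
by move=> /(_ conv); rewrite dotvNl; lra.
Qed.

Lemma lipschitz_ball rho : exists Lxx Lyy Lxy : R, [/\ 0 <= Lxx, 0 <= Lyy, 0 < Lxy &
  forall x x' y y', dg x -> dg x' -> df y -> df y' ->
    enorm x <= rho -> enorm x' <= rho -> enorm y <= rho -> enorm y' <= rho ->
    enorm (grady x y - grady x y') <= Lyy * enorm (y - y') /\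
    enorm (gradx x y - gradx x' y') <= Lxx * enorm (x - x') + Lxy * enorm (y - y')].
Proof.
have [_ _ _ lip] := hadm.
have [Lxx [Lyy [Lxy [h1 h2 h3 H]]]] :=
  lip _ _ (@enorm_bounded_set R q rho) (@enorm_bounded_set R p rho).
by exists Lxx, Lyy, Lxy; split => // x x' y y' *; apply: H.
Qed.

Lemma saddle_dom : dg xs /\ df ys.
Proof. by case: hs. Qed.

Lemma lagr_fin x y : dg x -> df y -> lagr g f Phi x y = (G x + Phi x y - F y)%:E.
Proof. by move=> gx fy; rewrite /lagr (edom_fin hg gx) (edom_fin hF fy). Qed.

Definition rgap x y : R := G x + Phi x ys - F ys - (G xs + Phi xs y - F y).

Lemma gapE x y : dg x -> df y -> gap g f Phi xs ys x y = (rgap x y)%:E.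
Proof. by have [gs fs] := saddle_dom; move=> gx fy; rewrite /gap !lagr_fin. Qed.

Lemma rgap_ge0 x y : dg x -> df y -> 0 <= rgap x y.
Proof.
have [gs fs] := saddle_dom; move=> gx fy; have [_ _ /(_ x y gx fy)[]] := hs.
by rewrite /= !lagr_fin // !lee_fin /rgap; lra.
Qed.

(* Phi need not be bounded by continuity, since the domains need not be closed;
   the bound comes from the Lipschitz gradients and a path through (xs, ys). *)
Lemma Phi_bounded rho : exists B : R, 0 <= B /\
  forall x y, dg x -> df y -> enorm x <= rho -> enorm y <= rho -> `|Phi x y| <= B.
Proof.
have [gs fs] := saddle_dom.
pose r := `|rho| + enorm xs + enorm ys.
have [xs0 ys0] := (enorm_ge0 xs, enorm_ge0 ys).
have rho0 := normr_ge0 rho; have rhor := ler_norm rho.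
have [Lxx [Lyy [Lxy [Lxx0 Lyy0 Lxy0 lip]]]] := lipschitz_ball r.
have r0 : 0 <= r by rewrite /r !addr_ge0.
have xsr : enorm xs <= r by rewrite /r; lra.
have ysr : enorm ys <= r by rewrite /r; lra.
pose Gm := enorm (gradx xs ys) + Lxx * (2 * r) + Lxy * (2 * r).
have dist n (u v : 'rV[R]_n) : enorm u <= r -> enorm v <= r -> enorm (u - v) <= 2 * r.
  by move=> ur vr; have := enormD u (- v); rewrite enormN; lra.
have gradx_le x y : dg x -> df y -> enorm x <= r -> enorm y <= r ->
    enorm (gradx x y) <= Gm.
  move=> gx fy xr yr.
  have [_ H] := lip x xs y ys gx gs fy fs xr xsr yr ysr.
  have := enormD (gradx x y - gradx xs ys) (gradx xs ys); rewrite subrK.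
  have : Lxx * enorm (x - xs) <= Lxx * (2 * r) by rewrite ler_wpM2l ?dist.
  have : Lxy * enorm (y - ys) <= Lxy * (2 * r) by rewrite ler_wpM2l ?(ltW Lxy0) ?dist.
  rewrite /Gm; lra.
(* The Lipschitz condition on [grady] keeps the first argument fixed, so the y-part of the path is
   taken at [xs]. *)
pose Gy := enorm (grady xs ys) + Lyy * (2 * r).
have grady_le y : df y -> enorm y <= r -> enorm (grady xs y) <= Gy.
  move=> fy yr.
  have [H _] := lip xs xs y ys gs gs fy fs xsr xsr yr ysr.
  have := enormD (grady xs y - grady xs ys) (grady xs ys); rewrite subrK.
  have : Lyy * enorm (y - ys) <= Lyy * (2 * r) by rewrite ler_wpM2l ?dist.
  rewrite /Gy; lra.
have cs n (u v : 'rV[R]_n) M : enorm u <= M -> enorm v <= 2 * r -> dotv u v <= M * (2 * r).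
  move=> uM vr; apply: le_trans (cauchy_schwarz u v) _.
  by rewrite ler_pM ?enorm_ge0.
have Gm0 : 0 <= Gm by rewrite (le_trans (enorm_ge0 _) (gradx_le xs ys gs fs xsr ysr)).
have Gy0 : 0 <= Gy by rewrite (le_trans (enorm_ge0 _) (grady_le ys fs ysr)).
exists (`|Phi xs ys| + Gm * (2 * r) + Gy * (2 * r)); split.
  by rewrite !addr_ge0 ?mulr_ge0.
move=> x y gx fy xr' yr'.
have xr : enorm x <= r by rewrite /r; lra.
have yr : enorm y <= r by rewrite /r; lra.
have d1 : dotv (gradx x y) (x - xs) <= Gm * (2 * r) by apply: cs; [exact: gradx_le|exact: dist].
have d1' : - dotv (gradx xs y) (x - xs) <= Gm * (2 * r).
  by rewrite -dotvNr opprB; apply: cs; [exact: gradx_le|exact: dist].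
have d2 : dotv (grady xs ys) (y - ys) <= Gy * (2 * r) by apply: cs; [exact: grady_le|exact: dist].
have d2' : - dotv (grady xs y) (y - ys) <= Gy * (2 * r).
  by rewrite -dotvNr opprB; apply: cs; [exact: grady_le|exact: dist].
have e1 := gradx_ineq gx gs fy; have e1' := gradx_ineq gs gx fy.
have e2 := grady_ineq gs fs fy; have e2' := grady_ineq gs fy fs.
rewrite -[X in dotv _ X]opprB dotvNr in e1; rewrite -[X in dotv _ X]opprB dotvNr in e2'.
have n1 := ler_norm (Phi xs ys); have n2 := ler_norm (- Phi xs ys); rewrite normrN in n2.
rewrite ler_norml; apply/andP; split; lra.
Qed.

(* grady itself may be unbounded: no regularity of grady in x is assumed, and its
   component orthogonal to the domain is arbitrary.  Only its slope towards
   points of the domain is controlled, through Phi on a segment of length 1. *)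
Lemma grady_slope_bound rho : exists C : R, 0 <= C /\
  forall x y v, dg x -> df y -> df v -> enorm x <= rho -> enorm y <= rho ->
    dotv (grady x y) (v - y) <= C * (1 + enorm (v - y)).
Proof.
have [B [B0 PhiB]] := Phi_bounded (rho + 1).
have [Lxx [Lyy [Lxy [_ Lyy0 _ lip]]]] := lipschitz_ball (rho + 1).
exists (2 * B + Lyy); split; first by rewrite addr_ge0 ?mulr_ge0.
move=> x y v gx fy fv xr yr.
have xr1 : enorm x <= rho + 1 by lra.
have yr1 : enorm y <= rho + 1 by lra.
(* Concavity at y bounds this slope only from below. The inequality at u bounds the slope there from
   above, and the Lipschitz condition transfers the bound from u to y. *)
have local u : df u -> enorm (u - y) <= 1 -> dotv (grady x y) (u - y) <= 2 * B + Lyy.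
  move=> fu uy1; have ur : enorm u <= rho + 1.
    by have := enormD (u - y) y; rewrite subrK; lra.
  have := PhiB x u gx fu xr1 ur; rewrite ler_norml => /andP[_ Pu].
  have := PhiB x y gx fy xr1 yr1; rewrite ler_norml => /andP[Py _].
  have H1 := grady_ineq gx fu fy.
  rewrite -[X in dotv _ X]opprB dotvNr in H1.
  have [H _] := lip x x y u gx gx fy fu xr1 xr1 yr1 ur.
  have := cauchy_schwarz (grady x y - grady x u) (u - y).
  rewrite dotvDl dotvNl => H2.
  have : enorm (grady x y - grady x u) * enorm (u - y) <= Lyy * 1 * 1.
    rewrite ler_pM ?enorm_ge0 // (le_trans H) // ler_wpM2l // enormC //.
  lra.
have C0 : 0 <= 2 * B + Lyy by rewrite addr_ge0 ?mulr_ge0.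
have e0 := enorm_ge0 (v - y).
have [v1|v1] := leP (enorm (v - y)) 1.
  by rewrite (le_trans (local _ fv v1)) // ler_peMr // lerDl.
set e := enorm _ in e0 v1 *.
have eV0 : 0 < e^-1 by rewrite invr_gt0; lra.
have eV1 : e^-1 < 1 by rewrite invf_lt1 //; lra.
have [fu _] := edom_convex hF eV0 eV1 fv fy.
have uE : e^-1 *: v + (1 - e^-1) *: y - y = e^-1 *: (v - y).
  by apply/rowP => i; rewrite !mxE; ring.
have := local _ fu; rewrite uE enormZ gtr0_norm // -/e mulVf ?gt_eqF //; last by lra.
move=> /(_ (lexx _)); rewrite dotvZr mulrC ler_pdivrMr; last by lra.
by move=> /le_trans; apply; rewrite ler_wpM2l // lerDr.
Qed.

End SaddleData.

(** * Runs of the algorithm *)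

Section Run.
Context {R : realType} {q p : nat}.
Variables (g : 'rV[R]_q -> \bar R) (f : 'rV[R]_p -> \bar R).
Variable Phi : 'rV[R]_q -> 'rV[R]_p -> R.
Variables (gradx : 'rV[R]_q -> 'rV[R]_p -> 'rV[R]_q)
          (grady : 'rV[R]_q -> 'rV[R]_p -> 'rV[R]_p).
Hypotheses (hg : proper_closed_convex g) (hF : proper_closed_convex (fconj f)).
Hypothesis hadm : admissible g f Phi gradx grady.
Variables (xs : 'rV[R]_q) (ys : 'rV[R]_p).
Hypothesis hs : saddle g f Phi (xs, ys).
Variables (P : npdal_params R) (S : npdal_run R q p).
Hypothesis hP : valid_params P.
Hypothesis hS : npdal_generated g f Phi gradx grady P S.

Local Notation dg := (edom g).
Local Notation df := (edom (fconj f)).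
Local Notation G x := (fine (g x)).
Local Notation F y := (fine (fconj f y)).
Local Notation psi := (par_psi P).
Local Notation a := (par_a P).
Local Notation b := (par_b P).
Local Notation xi := (par_xi P).
Local Notation nu := (par_nu P).
Local Notation mu := (par_mu P).
Local Notation phi := (par_phi P).
Local Notation beta := (par_beta P).
Local Notation taumax := (par_taumax P).
Local Notation x := (seq_x S).
Local Notation z := (seq_z S).
Local Notation y := (seq_y S).
Local Notation zb := (seq_zb S).
Local Notation tau := (seq_tau S).
Local Notation delta := (seq_delta S).

Let step n : npdal_step g f Phi gradx grady P S n.+1.
Proof. by have [_ /(_ n.+1 isT)] := hS. Qed.

Lemma tau_gt0 n : 0 < tau n.
Proof.
have [[_ _ _ _ [t0 _]] _] := hS.
elim: n => [|n IH]; first by rewrite t0; have /andP[] := vp_tau0 hP.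
have [i [-> _ _]] := step_tau (step n).
have /andP[phi1 _] := vp_phi hP; have /andP[mu0 _] := vp_mu hP.
by rewrite mulr_gt0 ?exprn_gt0 // /tau_init lt_min (vp_taumax hP) mulr_gt0 //; lra.
Qed.

Lemma tau_le_init n : tau n.+1 <= tau_init P S n.+1.
Proof.
have [i [-> _ _]] := step_tau (step n).
have /andP[phi1 _] := vp_phi hP; have /andP[mu0 mu1] := vp_mu hP.
rewrite ler_piMr ?exprn_ile1 ?ltW //.
by rewrite /tau_init lt_min (vp_taumax hP) mulr_gt0 ?tau_gt0 //; lra.
Qed.

Lemma tau_le_max n : tau n <= taumax.
Proof.
case: n => [|n]; last by rewrite (le_trans (tau_le_init n)) // ge_min lexx orbT.
by have [[_ _ _ _ [-> _]] _] := hS; have /andP[] := vp_tau0 hP.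
Qed.

Lemma delta_gt0 n : 0 < delta n.
Proof.
case: n => [|n]; last by rewrite (step_delta (step n)) divr_gt0 ?tau_gt0.
by have [[_ _ _ _ [_ ->]] _] := hS; exact: (vp_delta0 hP).
Qed.

Lemma delta_le_phi n : delta n.+1 <= phi.
Proof.
rewrite (step_delta (step n)) ler_pdivrMr ?tau_gt0 //.
by rewrite (le_trans (tau_le_init n)) // ge_min lexx.
Qed.

Lemma ytrial_edom n t : 0 < t -> df (ytrial f grady P S n t).
Proof. by move=> t0; apply: prox_edom; rewrite // mulr_gt0 // (vp_beta hP). Qed.

Lemma iterate_edom n : dg (x n) /\ df (y n).
Proof.
case: n => [|n]; first by have [[]] := hS.
split; first by rewrite (step_x (step n)); apply: prox_edom => //; exact: tau_gt0.
by rewrite (step_y (step n)); apply: ytrial_edom; exact: tau_gt0.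
Qed.

Let dgx n : dg (x n). Proof. by have [] := iterate_edom n. Qed.
Let dfy n : df (y n). Proof. by have [] := iterate_edom n. Qed.

(** * Energy inequality along a run *)

Lemma x_prox_ineq n u : dg u ->
  tau n * (G (x n.+1) - G u) <=
    dotv (x n.+1 - xmd P S n.+1) (u - x n.+1) + tau n * dotv (gradx (x n) (y n)) (u - x n.+1).
Proof.
move=> gu; have /= := prox_ineq hg (tau_gt0 n) (xmd P S n.+1 - tau n *: gradx (x n) (y n)) gu.
rewrite -(step_x (step n)) => H; apply: le_trans H _.
by rewrite -dotvZl -dotvDl opprB addrA addrAC.
Qed.

(** The step t is arbitrary, so that the inequality serves both the accepted y n and every trial
    point of the linesearch. *)
Lemma ytrial_prox_ineq n t w (v := ytrial f grady P S n t) : 0 < t -> df w ->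
  t * (F v - F w) <= beta^-1 * dotv (v - ymd P S n) (w - v)
    - t * dotv (grady (x n) (y n.-1)) (w - v).
Proof.
move=> t0 fw; have b0 := vp_beta hP.
have := prox_ineq hF (mulr_gt0 b0 t0) (ymd P S n + (beta * t) *: grady (x n) (y n.-1)) fw.
rewrite -/(ytrial f grady P S n t) -/v opprD addrA (dotvDl (v - _)) (dotvNl (_ *: _)) dotvZl => H.
rewrite -(ler_pM2l b0) [leRHS]mulrBr !mulrA mulfV ?gt_eqF // mul1r.
exact: H.
Qed.

(* The last summand is the primal part of rseq n: shifting it by one index makes
   the inequality of energy_descent telescope. *)
Definition energy n : R :=
  a * enorm (x n - xs) ^+ 2 + (1 - a) * psi / (psi - 1) * enorm (z n.+1 - xs) ^+ 2
  + a * enorm (x n - x n.-1) ^+ 2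
  + beta^-1 * (b * enorm (y n.-1 - ys) ^+ 2 + enorm (zb n - ys) ^+ 2)
  + omega1 P * delta n.-1 * enorm (x n - x n.-1) ^+ 2.

(** The primal condition enters twice: for x n.+2 tested at xs, and for x n.+1 tested at x n.+2. The
    second is multiplied by [delta n.+1], so that both carry the weight tau n.+1. Their gradient
    terms then combine into the gradient at (x n.+1, y n.+1) towards xs plus a [theta] term. The
    linesearch test bounds what [primal_descent] leaves of [theta], together with [Phiy]. *)
Lemma energy_descent n :
  2 * (tau n.+1 * rgap g f Phi xs ys (x n.+1) (y n.+1)) + energy n.+2
  <= energy n.+1 - (1 - nu) * rseq P S n.+1 + (1 - nu) * cseq P S n.+1.
Proof.
have [gs fs] := saddle_dom hs.
have t0 := tau_gt0 n; have t1 := tau_gt0 n.+1.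
have d0 := delta_gt0 n.+1; have dphi := delta_le_phi n.
have tE : tau n.+1 = delta n.+1 * tau n.
  by rewrite (step_delta (step n)) divfK ?gt_eqF.
have p1 := x_prox_ineq n.+1 gs.
have p2 := x_prox_ineq n (dgx n.+2).
have d1 := @ytrial_prox_ineq n.+1 _ _ t1 fs.
rewrite -(step_y (step n)) /= in d1.
have [i [_ acc _]] := step_tau (step n).
move: acc; rewrite /accept -(step_y (step n)) /=.
rewrite -/(rseq P S n.+1).
have Gx := gradx_ineq hg hadm (dgx n.+1) gs (dfy n.+1).
have Gy := grady_ineq hF hadm (dgx n.+1) (dfy n) fs.
have := @primal_descent _ _ hP _ (x n.+2) (x n.+1) (x n) (z n.+1) (z n.+2) (z n.+3)
  xs (theta gradx S n.+1 (y n.+1)) _ _ d0 dphi t0 (step_z (step n.+1)) (step_z (step n.+2)).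
have := @dual_identity _ P _ (y n.+1) (y n) (zb n.+1) (zb n.+2) ys (step_zb (step n.+1)).
rewrite -/(xmd P S n.+1) -/(xmd P S n.+2) -/(ymd P S n.+1) -tE.
have p2' : tau n.+1 * (G (x n.+1) - G (x n.+2)) <=
    delta n.+1 * dotv (x n.+1 - xmd P S n.+1) (x n.+2 - x n.+1)
    + tau n.+1 * dotv (gradx (x n) (y n)) (x n.+2 - x n.+1).
  by rewrite tE -!mulrA -mulrDr ler_pM2l.
have gE : dotv (gradx (x n.+1) (y n.+1)) (xs - x n.+2)
    + dotv (gradx (x n) (y n)) (x n.+2 - x n.+1)
    = dotv (gradx (x n.+1) (y n.+1)) (xs - x n.+1)
      + dotv (theta gradx S n.+1 (y n.+1)) (x n.+1 - x n.+2).
  by rewrite /theta !dotvE /=; ring.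
have hE : dotv (grady (x n.+1) (y n)) (ys - y n.+1) =
    dotv (grady (x n.+1) (y n)) (ys - y n) - dotv (grady (x n.+1) (y n)) (y n.+1 - y n).
  by rewrite !dotvE; ring.
have rE : rseq P S n.+1 = omega1 P * delta n * enorm (x n.+1 - x n) ^+ 2
    + beta^-1 * (b * enorm (y n.+1 - y n) ^+ 2
      + (1 - b) * (1 + b) * enorm (y n.+1 - zb n.+1) ^+ 2).
  by rewrite /rseq /rterm /=; ring.
move: p1 p2' d1 Gx Gy gE hE rE; rewrite /energy /rgap /Phiy /=.
set rs := rseq _ _ _; set cs := cseq _ _ _.
have bV : 0 < beta^-1 by rewrite invr_gt0 (vp_beta hP).
set D1 := dotv (x n.+2 - _) _; set D2 := dotv (x n.+1 - xmd _ _ _) _.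
set D3 := dotv (y n.+1 - _) _.
set gA := dotv (gradx (x n.+1) _) (xs - x n.+1).
set g1 := dotv (gradx (x n.+1) _) (xs - _).
set g0 := dotv (gradx (x n) _) _.
set gt := dotv (theta _ _ _ _) _; set h0 := dotv _ (ys - y n).
set h := dotv _ (ys - y n.+1); set h1 := dotv _ (y n.+1 - y n).
move=> p1 p2' d1 Gx Gy gE hE rE dual primal acc.
move: (tau n.+1) t1 p1 p2' d1 primal acc {tE d0 dphi p2} => t1 t10 p1 p2' d1 primal acc.
(* Each relation is multiplied by its weight beforehand, so that the final combination is linear in
   the resulting monomials. *)
have Gx' := ler_wpM2l (ltW t10) Gx; have Gy' := ler_wpM2l (ltW t10) Gy.
have gE' := congr1 (fun s => t1 * s) gE; rewrite /= !mulrDr in gE'.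
have hE' := congr1 (fun s => t1 * s) hE; rewrite /= !mulrDr in hE'.
have dual' := congr1 (fun s => beta^-1 * s) dual; rewrite /= in dual'.
clear gE hE dual Gx Gy bV.
clearbody D1 D2 D3 gA g1 g0 gt h0 h h1 rs cs.
lra.
Qed.

(** * Summed energy inequality; boundedness of iterates and trial points *)

Let rseq_ge0 n : 0 <= rseq P S n.
Proof.
have /andP[b0 b1] := vp_b hP; have beta0 := vp_beta hP.
have := delta_gt0 n.-1; have := vp_omega1 hP => om d0.
have b10 : 0 <= 1 - b by lra.
have b1p : 0 <= 1 + b by lra.
have := (ltW om, ltW d0, ltW beta0) => -[[H1 H2] H3].
have H4 : 0 <= beta^-1 by rewrite invr_ge0.
rewrite /rseq /rterm.
by repeat first [assumption | exact: sqr_ge0 | apply: addr_ge0 | apply: mulr_ge0].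
Qed.

Let cseq_ge0 n : 0 <= cseq P S n.
Proof.
rewrite /cseq; case: ifP => // _; have /andP[eta0 _] := vp_eta hP.
by rewrite mulr_ge0 ?divr_ge0 ?ler0n //; apply: sumr_ge0 => i _; exact: rseq_ge0.
Qed.

Lemma energy_ge0 n : 0 <= energy n.
Proof.
have beta0 := vp_beta hP; have /andP[a0 a1] := vp_a hP.
have /andP[psi1 _] := vp_psi hP; have /andP[b0 b1] := vp_b hP.
have om := vp_omega1 hP; have d0 := delta_gt0 n.-1.
have a10 : 0 <= 1 - a by lra.
have p10 : 0 <= psi - 1 by lra.
have p0 : 0 <= psi by lra.
have := (ltW om, ltW d0, ltW a0) => -[[H1 H2] H3].
have H4 : 0 <= beta^-1 by rewrite invr_ge0 ltW.
rewrite /energy.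
by repeat first [assumption | exact: sqr_ge0 | apply: addr_ge0 | apply: divr_ge0 | apply: mulr_ge0].
Qed.

Lemma gap_energy_bound : exists D : R, 0 < D /\ forall N,
  2 * \sum_(1 <= n < N.+1) tau n * rgap g f Phi xs ys (x n) (y n) + energy N.+1 <= D.
Proof.
have /andP[eta0 eta1] := vp_eta hP; have /andP[nu0 nu1] := vp_nu hP.
have [|K [K0 HK]] := window_sum_bound eta0 (ltW eta1) (vp_M hP) rseq_ge0 cseq_ge0.
  move=> n Mn; have n1 : (1 < n)%N by exact: leq_ltn_trans (vp_M hP) Mn.
  rewrite /cseq leqNgt n1 /= /window (maxn_idPl _) ?subn_gt0 //.
  by rewrite size_iota subKn // ltnW.
exists (energy 1 + (1 - nu) * K + 1); split.
  by rewrite ltr_wpDl // addr_ge0 ?energy_ge0 // mulr_ge0 // subr_ge0 ltW.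
move=> N.
suff H : 2 * (\sum_(1 <= n < N.+1) tau n * rgap g f Phi xs ys (x n) (y n)) + energy N.+1
    + (1 - nu) * \sum_(1 <= n < N.+1) rseq P S n
    <= energy 1 + (1 - nu) * \sum_(1 <= n < N.+1) cseq P S n.
  have nu10 : 0 <= 1 - nu by lra.
  have := ler_wpM2l nu10 (HK N); rewrite mulrDr; lra.
elim: N => [|N IH]; first by rewrite !big_geq // !mulr0 !addr0 add0r.
have rec (s : nat -> R) : \sum_(1 <= n < N.+2) s n = \sum_(1 <= n < N.+1) s n + s N.+1.
  by rewrite big_nat_recr.
rewrite !rec.
have := energy_descent N. lra.
Qed.

(** The energy controls x and zb directly, but y only with the weight b, which may be 0. So y is
    recovered from the averaging step: (1 - b) y n.+1 is zb n.+2 - b zb n.+1, and b < 1. *)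
Lemma iterates_bounded : exists B : R, 0 <= B /\ forall n,
  [/\ enorm (x n - xs) <= B, enorm (y n - ys) <= B & enorm (zb n - ys) <= B].
Proof.
have [D [D0 HD]] := gap_energy_bound.
have beta0 := vp_beta hP; have /andP[a0 a1] := vp_a hP.
have /andP[b0 b1] := vp_b hP; have /andP[psi1 _] := vp_psi hP.
(* Avoids a square root: if e > D / c + 1 then e > 1, so e^2 > e > D / c. *)
have sq (c e : R) : 0 < c -> c * e ^+ 2 <= D -> e <= D / c + 1.
  move=> c0 H; rewrite leNgt; apply/negP => He.
  have Dc : 0 < D / c by rewrite divr_gt0.
  have : e ^+ 2 <= D / c by rewrite ler_pdivlMr // mulrC.
  have : 0 <= (e - 1) * e by rewrite mulr_ge0; lra.
  lra.
have energyD n : energy n.+1 <= D.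
  apply: le_trans (HD n); rewrite lerDr mulr_ge0 //; apply: sumr_ge0 => i _.
  by rewrite mulr_ge0 ?(ltW (tau_gt0 i)) // (rgap_ge0 hg hF hs (dgx i) (dfy i)).
have parts n : a * enorm (x n.+1 - xs) ^+ 2 <= D /\ beta^-1 * enorm (zb n.+1 - ys) ^+ 2 <= D.
  have := energyD n; rewrite /energy /= => H.
  have om := vp_omega1 hP; have d0 := delta_gt0 n.
  have a10 : 0 <= 1 - a by lra.
  have p10 : 0 <= psi - 1 by lra.
  have p0 : 0 <= psi by lra.
  have H4 : 0 <= beta^-1 by rewrite invr_ge0 ltW.
  have n1 : 0 <= a * enorm (x n.+1 - xs) ^+ 2 by rewrite mulr_ge0 ?sqr_ge0 ?ltW.
  have n2 : 0 <= (1 - a) * psi / (psi - 1) * enorm (z n.+2 - xs) ^+ 2.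
    by rewrite mulr_ge0 ?sqr_ge0 // divr_ge0 // mulr_ge0.
  have n3 : 0 <= a * enorm (x n.+1 - x n) ^+ 2 by rewrite mulr_ge0 ?sqr_ge0 ?ltW.
  have n4 : 0 <= beta^-1 * (b * enorm (y n - ys) ^+ 2).
    by rewrite mulr_ge0 // mulr_ge0 // sqr_ge0.
  have n5 : 0 <= beta^-1 * enorm (zb n.+1 - ys) ^+ 2 by rewrite mulr_ge0 ?sqr_ge0.
  have n6 : 0 <= omega1 P * delta n * enorm (x n.+1 - x n) ^+ 2.
    by rewrite mulr_ge0 ?sqr_ge0 // mulr_ge0 // ltW.
  split; lra.
pose Bx := D / a + 1; pose Bz := D / beta^-1 + 1.
have Bx0 : 0 <= Bx by rewrite addr_ge0 ?divr_ge0 ?ltW.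
have Bz0 : 0 <= Bz by rewrite addr_ge0 ?divr_ge0 ?invr_ge0 ?ltW.
have b10 : 0 < 1 - b by lra.
pose By := 2 * Bz / (1 - b).
have By0 : 0 <= By by rewrite divr_ge0 ?(ltW b10) ?mulr_ge0.
have xB n : enorm (x n.+1 - xs) <= Bx by apply: sq; rewrite //; have [] := parts n.
have zB n : enorm (zb n.+1 - ys) <= Bz.
  by apply: sq; rewrite ?invr_gt0 //; have [] := parts n.
have yB n : enorm (y n.+1 - ys) <= By.
  rewrite /By ler_pdivlMr // mulrC -[X in X * _](gtr0_norm b10) -enormZ.
  have -> : (1 - b) *: (y n.+1 - ys) = (zb n.+2 - ys) + - (b *: (zb n.+1 - ys)).
    by rewrite (step_zb (step n.+1)) /=; apply/rowP => i; rewrite !mxE; ring.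
  apply: le_trans (enormD _ _) _; rewrite enormN enormZ ger0_norm //.
  have := zB n; have := zB n.+1; have : b * enorm (zb n.+1 - ys) <= 1 * enorm (zb n.+1 - ys).
    by rewrite ler_wpM2r ?enorm_ge0 ?ltW.
  lra.
have [x00 y00] := (enorm_ge0 (x 0%N - xs), enorm_ge0 (y 0%N - ys)).
exists (Bx + By + Bz + enorm (x 0%N - xs) + enorm (y 0%N - ys)); split.
  by clearbody Bx By Bz; lra.
have [[_ _ _ zb0 _] _] := hS.
case=> [|n]; first by rewrite zb0; split; lra.
have := xB n; have := yB n; have := zB n; split; lra.
Qed.

Lemma iterates_norm_bounded : exists rho, forall n,
  enorm (x n) <= rho /\ enorm (y n) <= rho.
Proof.
have [B [B0 HB]] := iterates_bounded.
exists (B + enorm xs + enorm ys) => n; have [xB yB _] := HB n.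
have := enormD (x n - xs) xs; have := enormD (y n - ys) ys; rewrite !subrK.
have := enorm_ge0 xs; have := enorm_ge0 ys; split; lra.
Qed.

(* The optimality condition of the trial point v, tested at ys, bounds
   |v - ys|^2 by an affine function of |v - ys|. *)
Lemma ytrial_bounded : exists rho, forall n (t : R), 0 < t -> t <= taumax ->
  enorm (ytrial f grady P S n.+1 t) <= rho.
Proof.
have [gs fs] := saddle_dom hs.
have [B [B0 HB]] := iterates_bounded.
have [rho Hrho] := iterates_norm_bounded.
have [A0 [A1 [A00 A10 minor]]] := affine_minorant hF.
have [Bp [Bp0 PhiB]] := Phi_bounded hg hF hadm hs (rho + enorm ys).
have [C [C0 slope]] := grady_slope_bound hg hF hadm hs rho.
have beta0 := vp_beta hP; have T0 := vp_taumax hP.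
have /andP[b0 b1] := vp_b hP.
have ys0 := enorm_ge0 ys.
pose K1 := `|F ys| + A0 + A1 * enorm ys + C * (1 + B) + 2 * Bp.
pose K2 := A1 + C.
have Fys0 := normr_ge0 (F ys).
have K10 : 0 <= K1.
  by rewrite /K1; have := mulr_ge0 A10 ys0; have := mulr_ge0 C0 (addr_ge0 ler01 B0); lra.
have K20 : 0 <= K2 by rewrite addr_ge0.
(* For e = |v - ys|, the bound e^2 <= B e + beta taumax (K1 + K2 e) and e >= 1 give e <= B + beta
   taumax (K1 + K2). The summand 1 covers e < 1. *)
exists (B + beta * taumax * (K1 + K2) + 1 + enorm ys) => n t t0 tT.
set v := ytrial f grady P S n.+1 t.
have fv : df v := ytrial_edom n.+1 t0.
have pr := @ytrial_prox_ineq n.+1 t ys t0 fs; rewrite -/v /= in pr.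
have [xB yB zB] := HB n.+1; have [xB' yB' zB'] := HB n.
have [xr _] := Hrho n.+1; have [_ yr] := Hrho n.
have sl := slope _ _ _ (dgx n.+1) (dfy n) fv xr yr.
have cc := grady_ineq hF hadm (dgx n.+1) (dfy n) fs.
have xr' : enorm (x n.+1) <= rho + enorm ys by lra.
have yr' : enorm (y n) <= rho + enorm ys by lra.
have sr' : enorm ys <= rho + enorm ys by have := enorm_ge0 (y n); lra.
have := PhiB _ _ (dgx n.+1) (dfy n) xr' yr'; rewrite ler_norml => /andP[_ P1].
have := PhiB _ _ (dgx n.+1) fs xr' sr'; rewrite ler_norml => /andP[P2 _].
have mv := minor _ fv.
set e := enorm (v - ys); have e0 : 0 <= e := enorm_ge0 _.
have ve : enorm v <= e + enorm ys by have := enormD (v - ys) ys; rewrite subrK.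
have vye : enorm (v - y n) <= e + B.
  have -> : v - y n = (v - ys) + - (y n - ys) by rewrite opprB addrA subrK.
  by apply: le_trans (enormD _ _) _; rewrite enormN lerD2l.
set H := grady (x n.+1) (y n) in pr sl cc.
(* The gradient H is taken at y n, so the direction is split there: concavity bounds the slope
   towards ys from below, the slope bound controls the one towards v from above. *)
have hE : dotv H (ys - v) = dotv H (ys - y n) - dotv H (v - y n).
  by rewrite !dotvE; ring.
have mdB : enorm (ymd P S n.+1 - ys) <= B.
  have -> : ymd P S n.+1 - ys = b *: (y n - ys) + (1 - b) *: (zb n.+1 - ys).
    by apply/rowP => i; rewrite /ymd !mxE /=; ring.
  apply: le_trans (enormD _ _) _; rewrite !enormZ ger0_norm // ger0_norm; last by lra.
  have h1 : b * enorm (y n - ys) <= b * B by rewrite ler_wpM2l.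
  have h2 : (1 - b) * enorm (zb n.+1 - ys) <= (1 - b) * B by rewrite ler_wpM2l //; lra.
  lra.
have sqE : dotv (v - ymd P S n.+1) (ys - v) =
    dotv (ymd P S n.+1 - ys) (v - ys) - e ^+ 2.
  by rewrite sqr_enorm !dotvE; ring.
have cs : dotv (ymd P S n.+1 - ys) (v - ys) <= B * e.
  by apply: le_trans (cauchy_schwarz _ _) _; rewrite ler_wpM2r.
have key : F ys - F v - dotv H (ys - v) <= K1 + K2 * e.
  rewrite hE /K1 /K2; have := ler_norm (F ys).
  have := ler_wpM2l A10 ve; have : C * (1 + enorm (v - y n)) <= C * (1 + (e + B)).
    by rewrite ler_wpM2l // lerD2l.
  lra.
have KK : 0 <= K1 + K2 * e by rewrite addr_ge0 // mulr_ge0.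
have : e ^+ 2 <= B * e + beta * taumax * (K1 + K2 * e).
  have : t * (F ys - F v - dotv H (ys - v)) <= taumax * (K1 + K2 * e).
    apply: le_trans (_ : t * (K1 + K2 * e) <= _); first by rewrite ler_pM2l.
    by rewrite ler_wpM2r.
  rewrite -(ler_pM2l beta0) => H1.
  have : beta * (t * (F v - F ys)) <= dotv (v - ymd P S n.+1) (ys - v)
      - beta * (t * dotv H (ys - v)).
    by move: pr; rewrite -(ler_pM2l beta0) [X in _ <= X -> _]mulrBr mulrA mulVKf ?gt_eqF.
  rewrite sqE; lra.
move=> eB; apply: le_trans ve _; rewrite lerD2r.
have BT : 0 <= beta * taumax by rewrite mulr_ge0 ?ltW.
have BK1 := mulr_ge0 BT K10; have BK2 := mulr_ge0 BT K20.
rewrite leNgt; apply/negP => elarge.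
have e1 : 1 <= e by lra.
have : 0 <= (e - 1) * (beta * taumax * K1) by rewrite mulr_ge0 // subr_ge0.
have : 0 < e * (e - (B + beta * taumax * (K1 + K2) + 1)) by rewrite mulr_gt0 ?subr_gt0 //; lra.
lra.
Qed.

(** * Lower bound on the step sizes *)

Lemma delta_lower : exists m : R, 0 < m /\ forall n, m * tau n <= delta n.
Proof.
have T0 := vp_taumax hP; have d0 := vp_delta0 hP.
(* For positive indices tau <= taumax gives the factor 1 / taumax. The minimum with delta0 takes
   care of index 0, where delta is a free parameter. *)
have m0 : 0 < Num.min 1 (par_delta0 P) / taumax by rewrite divr_gt0 // lt_min ltr01.
exists (Num.min 1 (par_delta0 P) / taumax); split => //.
case=> [|n].
  have [[_ _ _ _ [_ ->]] _] := hS.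
  apply: le_trans (_ : Num.min 1 (par_delta0 P) <= _); last by rewrite ge_min lexx orbT.
  by rewrite mulrAC ler_pdivrMr // ler_wpM2l ?tau_le_max // le_min ler01 ltW.
rewrite (step_delta (step n)) [leRHS]mulrC ler_wpM2r ?(ltW (tau_gt0 _)) //.
rewrite ler_pdivrMr // ler_pdivlMl ?tau_gt0 //.
apply: le_trans (tau_le_max n); rewrite ler_piMr ?(ltW (tau_gt0 _)) //.
by rewrite ge_min lexx.
Qed.

(* If b = 0 then zb n.+1 = y n, so one of the two dual terms always controls
   |v - y n|. *)
Lemma rterm_lower : exists k : R, 0 < k /\ forall n v,
  omega1 P * delta n * enorm (x n.+1 - x n) ^+ 2 + k * enorm (v - y n) ^+ 2
  <= rterm P S n.+1 v.
Proof.
have beta0 := vp_beta hP; have /andP[b0 b1] := vp_b hP.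
have bV : 0 < beta^-1 by rewrite invr_gt0.
have [bE|bN] := eqVneq b 0.
  exists beta^-1; split => // n v; rewrite /rterm /= -addrA lerD2l.
  rewrite (step_zb (step n)) /= bE !mul0r scale0r addr0 subr0 scale1r add0r.
  by rewrite addr0 !mulr1.
exists (b / beta); split; first by rewrite divr_gt0 // lt_def bN.
move=> n v; rewrite /rterm /= lerDl mulr_ge0 ?sqr_ge0 //.
by rewrite mulr_ge0 ?mulr_ge0 ?(ltW bV) //; lra.
Qed.

(** The uniform Lipschitz constants bound the left side of the test by t times squared increments of
    x and y, to be compared with nu times the same increments in [rterm]. The average [cseq] is
    dropped as nonnegative. In the x-part tau n occurs on both sides, through [delta_lower], and
    cancels. *)
Lemma accept_small : exists tbar : R, 0 < tbar /\ forall n (t : R), 0 < t -> t <= tbar ->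
  accept f Phi gradx grady P S n.+1 t.
Proof.
have T0 := vp_taumax hP; have /andP[nu0 nu1] := vp_nu hP.
have /andP[a0 a1] := vp_a hP; have xi0 := vp_xi hP; have om := vp_omega1 hP.
have [rho Hrho] := iterates_norm_bounded.
have [rho2 Hrho2] := ytrial_bounded.
have [m [m0 Hm]] := delta_lower.
have [k [k0 Hk]] := rterm_lower.
pose r := Num.max rho rho2.
have [Lxx [Lyy [Lxy [Lxx0 Lyy0 Lxy0 lip]]]] := lipschitz_ball hadm r.
pose c0 := (1 - a) * xi.
have c00 : 0 < c0 by rewrite mulr_gt0 //; lra.
(* [q1] bounds the coefficient of pp^2 once t and tau n are factored out, [q2] that of s^2 once t is
   factored out, using tau n <= taumax. The summand 1 keeps both positive for the division. *)
pose q1 := 2 * Lxx ^+ 2 / c0 + 1.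
pose q2 := 2 * taumax * Lxy ^+ 2 / c0 + 2 * Lyy + 1.
have [T0' c00'] := (ltW T0, ltW c00).
have q10 : 0 < q1 by rewrite ltr_wpDl // divr_ge0 // mulr_ge0 // sqr_ge0.
have q20 : 0 < q2.
  rewrite ltr_wpDl // addr_ge0 //; last exact: mulr_ge0.
  by rewrite divr_ge0 // mulr_ge0 ?sqr_ge0 // mulr_ge0.
pose tbar := Num.min taumax (Num.min (nu * omega1 P * m / q1) (nu * k / q2)).
have tbar0 : 0 < tbar.
  by rewrite !lt_min T0 !divr_gt0 ?mulr_gt0.
exists tbar; split => // n t t0; rewrite !le_min => /and3P[tT tq1 tq2].
rewrite ler_pdivlMr // in tq1; rewrite ler_pdivlMr // in tq2.
rewrite /accept -/c0; set v := ytrial _ _ _ _ _ _.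
have fv : df v := ytrial_edom n.+1 t0.
have vr : enorm v <= r by rewrite le_max Hrho2 // orbT.
have [xr yr'] := Hrho n; have [xr1 _] := Hrho n.+1.
have x0r : enorm (x n) <= r by rewrite le_max xr.
have y0r : enorm (y n) <= r by rewrite le_max yr'.
have x1r : enorm (x n.+1) <= r by rewrite le_max xr1.
have [ly _] := lip _ _ _ _ (dgx n.+1) (dgx n.+1) (dfy n) fv x1r x1r y0r vr.
have [_ lx] := lip _ _ _ _ (dgx n.+1) (dgx n) fv (dfy n) x1r x0r vr y0r.
set s := enorm (v - y n) in lx; set pp := enorm (x n.+1 - x n) in lx.
have s0 : 0 <= s := enorm_ge0 _; have pp0 : 0 <= pp := enorm_ge0 _.
have thle : enorm (theta gradx S n.+1 v) ^+ 2 <= 2 * Lxx ^+ 2 * pp ^+ 2 + 2 * Lxy ^+ 2 * s ^+ 2.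
  apply: le_trans (_ : (Lxx * pp + Lxy * s) ^+ 2 <= _).
    by rewrite ler_pXn2r ?nnegrE ?enorm_ge0 // addr_ge0 ?mulr_ge0 // ltW.
  have := sqr_ge0 (Lxx * pp - Lxy * s); lra.
(* Concavity at v replaces the difference of values of Phi by a slope at v, which leaves a
   difference of two gradients and avoids integration. *)
have Ple : Phiy Phi grady S n.+1 v <= Lyy * s ^+ 2.
  have := grady_ineq hF hadm (dgx n.+1) fv (dfy n).
  rewrite -[X in dotv _ X]opprB dotvNr => H1.
  have := cauchy_schwarz (grady (x n.+1) (y n) - grady (x n.+1) v) (v - y n).
  rewrite dotvDl dotvNl -/s => H2.
  have : enorm (grady (x n.+1) (y n) - grady (x n.+1) v) * s <= Lyy * s ^+ 2.
    by rewrite expr2 mulrA ler_wpM2r // (le_trans ly) // enormC.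
  rewrite /Phiy /=; lra.
have cc : 0 <= (1 - nu) * cseq P S n.+1 by rewrite mulr_ge0 ?cseq_ge0 //; lra.
apply: le_trans (_ : nu * rterm P S n.+1 v <= _); last by rewrite lerDl.
have := ler_wpM2l (ltW nu0) (Hk n v); rewrite -/s -/pp; apply: le_trans.
have tn0 := tau_gt0 n; have tnT := tau_le_max n; have Hmn := Hm n.
rewrite -[n.+1.-1]/n.
have th2 : t * tau n / c0 * enorm (theta gradx S n.+1 v) ^+ 2 <=
    t * tau n / c0 * (2 * Lxx ^+ 2 * pp ^+ 2 + 2 * Lxy ^+ 2 * s ^+ 2).
  by rewrite ler_wpM2l // divr_ge0 // mulr_ge0 // ltW.
have P2 : 2 * t * Phiy Phi grady S n.+1 v <= 2 * t * (Lyy * s ^+ 2).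
  by rewrite ler_wpM2l // mulr_ge0 // ltW.
have ppart : t * tau n / c0 * (2 * Lxx ^+ 2 * pp ^+ 2) <= nu * (omega1 P * delta n * pp ^+ 2).
  rewrite (_ : _ * _ = (t * (q1 - 1)) * tau n * pp ^+ 2); last first.
    by rewrite /q1; field; rewrite gt_eqF.
  rewrite [leRHS]mulrA [nu * _]mulrA ler_wpM2r ?sqr_ge0 //.
  apply: le_trans (_ : nu * omega1 P * (m * tau n) <= _); last first.
    by rewrite ler_wpM2l // mulr_ge0 // ltW.
  rewrite !mulrA ler_wpM2r ?(ltW tn0) //; lra.
have spart : t * tau n / c0 * (2 * Lxy ^+ 2 * s ^+ 2) + 2 * t * (Lyy * s ^+ 2) <= nu * (k * s ^+ 2).
  rewrite (_ : _ + _ = (t * (2 * tau n * Lxy ^+ 2 / c0 + 2 * Lyy)) * s ^+ 2); last by ring.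
  rewrite mulrA ler_wpM2r ?sqr_ge0 //; apply: le_trans tq2.
  rewrite ler_pM2l // /q2.
  have : 2 * tau n * Lxy ^+ 2 / c0 <= 2 * taumax * Lxy ^+ 2 / c0.
    by rewrite ler_wpM2r ?invr_ge0 ?(ltW c00) // ler_wpM2r ?sqr_ge0 // ler_wpM2l.
  lra.
move: th2 P2 ppart spart; rewrite !mulrDr; lra.
Qed.

(** After backtracking, the previous trial step tau / mu was rejected and so is at least [tbar].
    Without backtracking, phi > 1 and tau n <= taumax show that the step does not decrease. *)
Lemma tau_lower : exists tlow : R, 0 < tlow /\ forall n, tlow <= tau n.
Proof.
have [tbar [tbar0 Hacc]] := accept_small.
have /andP[mu0 mu1] := vp_mu hP; have /andP[phi1 _] := vp_phi hP.
exists (Num.min (tau 0%N) (mu * tbar)); split.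
  by rewrite lt_min tau_gt0 mulr_gt0.
elim=> [|n IH]; first by rewrite ge_min lexx.
have ti0 : 0 < tau_init P S n.+1.
  by rewrite /tau_init lt_min (vp_taumax hP) mulr_gt0 ?tau_gt0 //; lra.
have [[|i] [-> _ rej]] := step_tau (step n).
  rewrite expr0 mulr1 (le_trans IH) // /tau_init le_min tau_le_max andbT /=.
  by rewrite ler_peMl ?ltW ?tau_gt0.
have := rej i (ltnSn i); rewrite exprS mulrCA => nacc.
rewrite ge_min; apply/orP; right; rewrite ler_pM2l // leNgt; apply/negP => small.
by apply: nacc; apply: Hacc; [rewrite mulr_gt0 ?exprn_gt0 | exact: ltW].
Qed.

(** * Gap at the averaged iterates *)

Lemma Phi_convex_x w u v (t : R) : df w -> 0 < t -> t < 1 -> dg u -> dg v ->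
  Phi (t *: u + (1 - t) *: v) w <= t * Phi u w + (1 - t) * Phi v w.
Proof.
move=> fw t0 t1 gu gv; have [_ _ [_ /(_ w fw)[ck _] _] _] := hadm.
exact: (convex_function_ineq ck t0 t1 gu gv).
Qed.

Lemma Phi_concave_y w u v (t : R) : dg w -> 0 < t -> t < 1 -> df u -> df v ->
  t * Phi w u + (1 - t) * Phi w v <= Phi w (t *: u + (1 - t) *: v).
Proof.
move=> gw t0 t1 fu fv; have [_ _ [_ _ /(_ w gw)[ck _]] _] := hadm.
have := convex_function_ineq ck t0 t1 fu fv; lra.
Qed.

Lemma gap_average_bound : exists C1 : R, 0 < C1 /\ forall N, (1 <= N)%N ->
  (gap g f Phi xs ys (xhat S N) (yhat S N) <= (C1 / N%:R)%:E)%E.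
Proof.
have [gs fs] := saddle_dom hs.
have [D [D0 HD]] := gap_energy_bound; have [tlow [tl0 Hlow]] := tau_lower.
exists (D / tlow); split; first exact: divr_gt0.
move=> N N1.
have convx (u v : 'rV[R]_q) (t : R) : 0 < t -> t < 1 -> dg u -> dg v ->
    dg (t *: u + (1 - t) *: v) /\
    G (t *: u + (1 - t) *: v) + Phi (t *: u + (1 - t) *: v) ys <=
      t * (G u + Phi u ys) + (1 - t) * (G v + Phi v ys).
  move=> t0 t1 gu gv; have [gw Gw] := edom_convex hg t0 t1 gu gv.
  by split => //; have := Phi_convex_x fs t0 t1 gu gv; lra.
have convy (u v : 'rV[R]_p) (t : R) : 0 < t -> t < 1 -> df u -> df v ->
    df (t *: u + (1 - t) *: v) /\
    F (t *: u + (1 - t) *: v) - Phi xs (t *: u + (1 - t) *: v) <=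
      t * (F u - Phi xs u) + (1 - t) * (F v - Phi xs v).
  move=> t0 t1 fu fv; have [fw Fw] := edom_convex hF t0 t1 fu fv.
  by split => //; have := Phi_concave_y gs t0 t1 fu fv; lra.
have tpos i : (1 <= i)%N -> 0 < tau i by move=> _; exact: tau_gt0.
have [s0 gx kx] := weighted_jensen (k := fun u => G u + Phi u ys) convx
  (fun i _ => dgx i) tpos N1.
have [_ fy ky] := weighted_jensen (k := fun u => F u - Phi xs u) convy
  (fun i _ => dfy i) tpos N1.
rewrite -/(stepsum S N) in s0 gx kx fy ky.
rewrite -/(xhat S N) in gx kx; rewrite -/(yhat S N) in fy ky.
rewrite (gapE hg hF hs gx fy) lee_fin.
have gap0 := rgap_ge0 hg hF hs gx fy.
have sumE : \sum_(1 <= n < N.+1) tau n * rgap g f Phi xs ys (x n) (y n) =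
    \sum_(1 <= n < N.+1) tau n * (G (x n) + Phi (x n) ys)
    + \sum_(1 <= n < N.+1) tau n * (F (y n) - Phi xs (y n))
    - stepsum S N * (F ys + G xs).
  rewrite /stepsum mulr_suml -big_split -sumrB /=; apply: eq_bigr => n _.
  by rewrite /rgap; ring.
have sN : N%:R * tlow <= stepsum S N.
  rewrite /stepsum (_ : N%:R * tlow = \sum_(1 <= n < N.+1) tlow).
    by apply: ler_sum => n _; exact: Hlow.
  by rewrite sumr_const_nat subSS subn0 mulr_natl.
rewrite -mulrA -invfM ler_pdivlMr; last by rewrite mulr_gt0 // ltr0n.
(* Replacing N tlow by the larger s_N is legitimate because the gap at the averages is
   nonnegative. *)
apply: le_trans (_ : rgap g f Phi xs ys (xhat S N) (yhat S N) * stepsum S N <= _).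
  by rewrite ler_wpM2l // mulrC.
have := HD N; rewrite sumE; have := energy_ge0 N.+1; rewrite /rgap in gap0 *.
have := mulr_ge0 gap0 (ltW s0); lra.
Qed.


End Run.

Unset Implicit Arguments.

Theorem theorem2 (R : realType) (q p : nat)
    (g : 'rV[R]_q -> \bar R) (f : 'rV[R]_p -> \bar R)
    (Phi : 'rV[R]_q -> 'rV[R]_p -> R)
    (gradx : 'rV[R]_q -> 'rV[R]_p -> 'rV[R]_q)
    (grady : 'rV[R]_q -> 'rV[R]_p -> 'rV[R]_p)
    (hg : proper_closed_convex g) (hf : proper_closed_convex f)
    (hadm : admissible g f Phi gradx grady)
    (xs : 'rV[R]_q) (ys : 'rV[R]_p) (hs : saddle g f Phi (xs, ys))
    (P : npdal_params R) (hP : valid_params P)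
    (S : npdal_run R q p)
    (hS : npdal_generated g f Phi gradx grady P S) :
  exists C1 : R, 0 < C1 /\
    forall N : nat, (1 <= N)%N ->
      (gap g f Phi xs ys (xhat S N) (yhat S N) <= (C1 / N%:R)%:E)%E.
Proof.
have hF : proper_closed_convex (fconj f).
  by case: hf => pf _ _; apply: (fconj_pcc pf); case: hs => _ ? _; exists ys.
exact: (gap_average_bound hg hF hadm hs hP hS).
Qed.
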